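(* Let $G=\mathbb{T}\times\mathbb{R}^n\times V\times H$ be a connected translation complete subgroup of $G_{aWH}$, embedded canonically into $\mathbb{H}^n\rtimes Sp(n,\mathbb{R})$. Let $\psi\in L^1(\mathbb{R}^n)\cap L^2(\mathbb{R}^n)$. Then the wavelet admissibility condition and the Wigner admissibility condition coincide, that is, $$\int_G W_\psi\big((z,p,q,h)^{-1}\cdot(x,\xi)\big)\,d(z,p,q,h)=\int_{V\rtimes H^T}|\widehat\psi(h^T(\xi-q))|^2\,d\mu(q,h)$$ holds for all $x\in\mathbb{R}^n$ and almost all $\xi\in\mathbb{R}^n$.
   Context: The dual group $\widehat{\mathbb{R}^n}$ is identified with $\mathbb{R}^n$ (column vectors) by associating to $\xi$ the character $x\mapsto e^{2\pi i\langle x,\xi\rangle}$; $\widehat\psi(\gamma)=\int\psi(x)e^{-2\pi i\langle\gamma,x\rangle}dx$. The affine Weyl-Heisenberg group is $G_{aWH}=\mathbb{T}\times\mathbb{R}^n\times\widehat{\mathbb{R}^n}\times\mathrm{GL}(n,\mathbb{R})$ with group law $(z_1,x_1,\xi_1,h_1)(z_2,x_2,\xi_2,h_2)=(z_1z_2e^{2\pi i\langle\xi_1,h_1x_2\rangle},\,x_1+h_1x_2,\,\xi_1+h_1^{-T}\xi_2,\,h_1h_2)$, where $h^{-T}=(h^{-1})^T$. A translation complete subgroup is a subgroup $G=\mathbb{T}\times\mathbb{R}^n\times V\times H$, where $V\subset\widehat{\mathbb{R}^n}$ is a linear subspace, $H$ is a closed subgroup of $\mathrm{GL}(n,\mathbb{R})$,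 and $h^TV\subset V$ for all $h\in H$. The left Haar measure of $G$ is $d(z,p,q,h)=|\det(h^T|_V)|\,dz\,dp\,dq\,\frac{dh}{|\det h|}$ ($dz$ normalized on $\mathbb{T}$, $dp,dq$ Lebesgue measures on $\mathbb{R}^n$ and $V$, $dh$ left Haar measure on $H$). $V\rtimes H^T$ is the set $V\times H$ with law $(\xi_1,h_1)(\xi_2,h_2)=(\xi_1+h_1^{-T}\xi_2,h_1h_2)$ and left Haar measure $d\mu(q,h)=|\det(h^T|_V)|\,dq\,dh$. $\mathbb{H}^n=\mathbb{T}\times\mathbb{R}^n\times\widehat{\mathbb{R}^n}$ is the reduced Heisenberg group (the subgroup of $G_{aWH}$ with trivial matrix part), $Sp(n,\mathbb{R})\subset\mathrm{GL}(2n,\mathbb{R})$ is the symplectic group, acting linearly on the component $(x,\xi)\in\mathbb{R}^{2n}$ of $\mathbb{H}^n$, and the canonical embedding $G_{aWH}\hookrightarrow\mathbb{H}^n\rtimes Sp(n,\mathbb{R})$ is $(z,x,\xi,h)\mapsto((z,x,\xi),\mathrm{diag}(h,h^{-T}))$. $\mathbb{H}^n\rtimes Sp(n,\mathbb{R})$ acts on $\mathbb{R}^{2n}=\mathbb{R}^n\times\mathbb{R}^n$ by $(z,p,q,B)\cdot y=By+(p,q)$; hence for $(z,p,q,h)\in G$ one has $(z,p,q,h)^{-1}\cdot(x,\xi)=(h^{-1}(x-p),\,h^T(\xi-q))$. The Wigner distribution is $W_\psi(x,\xi)=\int_{\mathbb{R}^n}e^{-2\pi i\langle\xi,y\rangle}\psi(x+\tfrac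 y2)\overline{\psi(x-\tfrac y2)}\,dy$. The left-hand side of the identity is the Wigner admissibility expression, the right-hand side is the wavelet (Calderón-type) admissibility expression.
   Formalization: The integral over G may be undefined (e.g. ψ a box function, H trivial, V = R), so the identity is stated for it when its positive or negative part has finite integral, and always as an iterated integral, over T×R^n first and then over V⋊H^T. *)

(* Defs.v *)
From HB Require Import structures.
From mathcomp Require Import all_boot all_order all_algebra.
From mathcomp Require Import all_classical all_reals all_analysis.
From mathcomp Require Import measurable_realfun complex ring lra.

Set Implicit Arguments.
Unset Strict Implicit.
Unset Printing Implicit Defensive.

Import Order.TTheory GRing.Theory Num.Theory numFieldNormedType.Exports.
Import ComplexField.Normc.

Local Open Scope classical_set_scope.
Local Open Scope ring_scope.

HB.instance Definition _ (R : realType) := isPointed.Build R[i] 0.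
HB.instance Definition _ (R : realType) :=
  PseudoMetric.copy R[i] (R[i] : numFieldType).
HB.instance Definition _ (R : realType) :=
  Measurable.copy R[i] (g_sigma_algebraType (open : set (set R[i]))).
HB.instance Definition _ (R : realType) (m n : nat) :=
  Measurable.copy 'M[R]_(m, n) (g_sigma_algebraType (open : set (set 'M[R]_(m, n)))).

Section borel.
Variable R : realType.
Implicit Types (m n : nat) (V : Type).

Lemma measurable_mxP d (T : measurableType d) m n (f : T -> 'M[R]_(m, n)) :
  (forall i j, measurable_fun setT (fun t => f t i j)) ->
  measurable_fun setT f.
Proof.
move=> mf; apply: (@measurability _ _ _ _ _ _ (@open 'M[R]_(m, n))) => //.
move=> _ [U oU <-]; rewrite setTI.
pose B (p : 'M[rat]_(m, n) * rat) := [set t : T |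
  forall i j, `|ratr (p.1 i j) - f t i j| < ratr p.2].
have mB p : measurable (B p).
  have -> : B p = \big[setI/setT]_i \big[setI/setT]_j
      [set t | `|ratr (p.1 i j) - f t i j| < ratr p.2].
    rewrite predeqE => t; rewrite -bigcap_seq; split.
      by move=> Bt i _; rewrite -bigcap_seq => j _; exact: Bt.
    move=> Bt i j; have := Bt i (mem_index_enum i).
    by rewrite -bigcap_seq; apply; exact: (mem_index_enum j).
  apply: bigsetI_measurable => i _; apply: bigsetI_measurable => j _.
  have mg : measurable_fun setT (fun t => `|ratr (p.1 i j) - f t i j| : R).
    by apply: measurableT_comp => //; exact: measurable_funB.
  have := mg measurableT `]-oo, ratr p.2[%classic (measurable_itv _).
  rewrite setTI; congr measurable; by rewrite set_itvNyo.
pose F k := if (unpickle k : option ('M[rat]_(m, n) * rat)) is Some (Q, r)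
  then
  if (0 < r) && `[< ball (map_mx ratr Q : 'M[R]_(m, n)) (ratr r) `<=` U >]
  then B (Q, r) else set0 else set0.
have -> : f @^-1` U = \bigcup_k F k.
  apply/seteqP; split => t /=.
    move=> Uft; have /nbhs_ballP[e /= e0 eU] : nbhs (f t : 'M[R]_(m, n)) U.
      exact: open_nbhs_nbhs.
    have e20 : 0 < e / 2 by rewrite divr_gt0.
    have [r] := rat_in_itvoo e20; rewrite in_itv /= => /andP[r0 re].
    have Q i j : exists q : rat, `|ratr q - f t i j| < ratr r.
      have lt : f t i j - ratr r < f t i j + ratr r.
        by rewrite ltrD2l gtrN.
      have [q] := rat_in_itvoo lt; rewrite in_itv /= => qr.
      by exists q; rewrite ltr_distl.
    pose q i j := sval (cid (Q i j)).
    pose M : 'M[rat]_(m, n) := \matrix_(i, j) q i j.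
    exists (pickle (M, r)) => //; rewrite /F pickleK.
    have Mt i j : `|ratr (M i j) - f t i j| < ratr r.
      by rewrite mxE; exact: (svalP (cid (Q i j))).
    rewrite -(ltr0q R) r0/=; case: asboolP => [_|]; first exact: Mt.
    case; move=> A [_ MA]; apply: eU; split => // i j.
    rewrite /ball /= (le_lt_trans (ler_distD (ratr (M i j)) _ _))//.
    rewrite (splitr e) ltrD//; first by rewrite distrC (lt_trans (Mt i j)).
    by have := MA i j; rewrite /ball /= mxE => /lt_trans; apply.
  move=> [k _]; rewrite /F; case: unpickle => // -[Q r].
  case: ltP => //= r0; case: asboolP => // QU Bt; apply: QU; split.
    by rewrite ltr0q.
  by move=> i j; rewrite /ball /= mxE; exact: Bt.
apply: bigcupT_measurable => k; rewrite /F.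
case: unpickle => [[Q r]|]; last exact: measurable0.
by case: ifP => _; [exact: mB|exact: measurable0].
Qed.

Lemma measurable_coord_mx m n i j :
  measurable_fun setT (fun A : 'M[R]_(m, n) => A i j).
Proof.
apply: (measurability _ (RGenOpens.measurableE R)) => _ [_ [a [b ->] <-]].
rewrite setTI; apply: sub_sigma_algebra.
by apply: open_comp; [move=> A _; exact: coord_continuous|exact: interval_open].
Qed.

Lemma measurable_complexP d (T : measurableType d) (f : T -> R[i]) :
  measurable_fun setT (fun t => complex.Re (f t)) ->
  measurable_fun setT (fun t => complex.Im (f t)) ->
  measurable_fun setT f.
Proof.
move=> mr mi.
pose row t : 'M[R]_(2, 1) :=
  \col_i (if i == 0 then complex.Re (f t) else complex.Im (f t)).
pose phi (A : 'M[R]_(2, 1)) : R[i] := (A 0 0 +i* A 1 0)%C.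
have -> : f = phi \o row.
  by apply/funext => t; rewrite /phi/= !mxE/=; case: (f t).
apply: measurableT_comp; last first.
  apply: measurable_mxP => i j; rewrite /row.
  by under eq_fun do [rewrite mxE]; case: (i == 0).
apply: (@measurability _ _ _ _ _ _ (@open R[i])) => // _ [U oU <-].
rewrite setTI; apply: sub_sigma_algebra; apply: open_comp => // A _.
move=> W /nbhs_ballP[e /= e0 eW]; apply/nbhs_ballP.
move: e e0 eW => [r s]; rewrite ltcE/= => /andP[/eqP-> r0] rW.
exists (r / 2) => /=; first by rewrite divr_gt0.
move=> B [_ AB]; apply: rW; rewrite /ball/= /phi ltcR.
have := AB 0 0; have := AB 1 0; rewrite /ball/= => B1 B0.
rewrite -[ltRHS]ger0_norm ?(ltW r0)// -sqrtr_sqr ltr_sqrt ?exprn_gt0//.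
set a := A 0 0 - B 0 0 in B0 *; set b := A 1 0 - B 1 0 in B1 *.
have h (x : R) : `|x| < r / 2 -> x ^+ 2 < r ^+ 2 / 4.
  by rewrite ltr_norml => /andP[? ?]; nra.
by move: (h _ B0) (h _ B1) (exprn_gt0 2 r0); lra.
Qed.

Definition cons_cV n (p : measurableTypeR R * 'cV[R]_n) : 'cV[R]_n.+1 :=
  col_mx (p.1 : R)%:M p.2.

Lemma measurable_cons_cV n : measurable_fun setT (@cons_cV n).
Proof.
apply: measurable_mxP => i j; case: (@split_ordP 1 n i) => k ->.
  apply: (eq_measurable_fun fst) => // p _.
  by rewrite /cons_cV (@col_mxEu _ 1 n 1) mxE !ord1 eqxx mulr1n.
have -> : (fun p => cons_cV p (rshift 1 k) j) =
    (fun A : 'cV[R]_n => A k j) \o snd.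
  by apply/funext => p; rewrite /cons_cV (@col_mxEd _ 1 n 1).
apply: measurableT_comp => //.
exact: measurable_coord_mx.
Qed.
HB.instance Definition _ n :=
  isMeasurableFun.Build _ _ _ _ (@cons_cV n) (@measurable_cons_cV n).

Section lebesgue_cons.
Variables (n : nat) (mu : {sigma_finite_measure set 'cV[R]_n -> \bar R}).

Definition lebesgue_cons : set 'cV[R]_n.+1 -> \bar R :=
  pushforward (@lebesgue_measure R \x mu)%E (@cons_cV n).

Let lebesgue_cons0 : lebesgue_cons set0 = 0%E.
Proof. exact: measure0. Qed.

Let lebesgue_cons_ge0 A : (0 <= lebesgue_cons A)%E.
Proof. exact: measure_ge0. Qed.

Let lebesgue_cons_sigma_additive : semi_sigma_additive lebesgue_cons.
Proof. exact: measure_semi_sigma_additive. Qed.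

HB.instance Definition _ := isMeasure.Build _ _ _ lebesgue_cons
  lebesgue_cons0 lebesgue_cons_ge0 lebesgue_cons_sigma_additive.

Let lebesgue_product_sigma_finite :
  sigma_finite setT (@lebesgue_measure R \x mu)%E.
Proof.
have /sigma_finiteP[F [TF ndF Foo]] := sigma_finiteT (@lebesgue_measure R).
have /sigma_finiteP[G [TG ndG Goo]] := sigma_finiteT mu.
exists (fun k => F k `*` G k).
  rewrite -setXTT TF TG predeqE => -[x y]; split.
    move=> [/= [k _ Fkx] [l _ Gly]]; exists (maxn k l) => //; split.
    - by move: x Fkx; exact/subsetPset/ndF/leq_maxl.
    - by move: y Gly; exact/subsetPset/ndG/leq_maxr.
  by move=> [k _ []/= ? ?]; split; exists k.
move=> k; have [? ?] := Foo k; have [? ?] := Goo k.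
split; first exact: measurableX.
by rewrite product_measure1E// lte_mul_pinfty// ge0_fin_numE.
Qed.

Let lebesgue_cons_sigma_finite : sigma_finite setT lebesgue_cons.
Proof.
have [F FT Foo] := lebesgue_product_sigma_finite.
pose uncons (v : 'cV[R]_(1 + n)) : measurableTypeR R * 'cV[R]_n := (v 0 0, dsubmx v).
have mu_ : measurable_fun setT uncons.
  apply: measurable_fun_pair; first exact: measurable_coord_mx.
  apply: measurable_mxP => i j; under eq_fun do [rewrite mxE].
  exact: measurable_coord_mx.
have consK : cancel (@cons_cV n) uncons.
  move=> [x v]; rewrite /uncons /cons_cV col_mxKd; congr pair.
  have -> : 0 = lshift n (0 : 'I_1) :> 'I_n.+1 by exact/val_inj.
  by rewrite (@col_mxEu _ 1 n 1) mxE.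
exists (fun k => uncons @^-1` F k).
  by rewrite -preimage_bigcup -FT preimage_setT.
move=> k; have [mF Foo'] := Foo k; split.
  by rewrite -[X in measurable X]setTI; exact: mu_.
rewrite /lebesgue_cons /pushforward -comp_preimage.
by rewrite (_ : uncons \o _ = id) //; apply/funext => p /=; rewrite consK.
Qed.
HB.instance Definition _ := Measure_isSigmaFinite.Build _ _ _
  lebesgue_cons lebesgue_cons_sigma_finite.
End lebesgue_cons.

Fixpoint lebesgue_cV n : {sigma_finite_measure set 'cV[R]_n -> \bar R} :=
  match n with
  | 0 => \d_(0 : 'cV[R]_0)
  | m.+1 => lebesgue_cons (lebesgue_cV m)
  end.

Lemma measurable_box n (A : 'I_n -> set R) :
  (forall i, measurable (A i)) ->
  measurable [set x : 'cV[R]_n | forall i, A i (x i 0)].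
Proof.
move=> mA; rewrite (_ : [set _ | _] =
    \big[setI/setT]_i ((fun x : 'cV[R]_n => x i 0) @^-1` A i)).
  apply: bigsetI_measurable => i _; rewrite -[X in measurable X]setTI.
  by apply: measurable_coord_mx => //; exact: mA.
rewrite -bigcap_seq; apply/seteqP; split => x /=; first by move=> Ax i _.
by move=> Ax i; apply: Ax; exact: mem_index_enum.
Qed.

Lemma lebesgue_cV_box n (A : 'I_n -> set R) :
  (forall i, measurable (A i)) ->
  lebesgue_cV n [set x | forall i, A i (x i 0)] =
  (\prod_(i < n) @lebesgue_measure R (A i))%E.
Proof.
elim: n A => [|n IHn] A mA.
  by rewrite big_ord0 /= diracE mem_set// => -[].
rewrite big_ord_recl -IHn; last by move=> i; exact: mA.
rewrite /= /lebesgue_cons /pushforward -product_measure1E; first last.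
- by apply: (@measurable_box n (fun i => A (lift ord0 i))) => i; exact: mA.
- exact: mA.
congr (product_measure1 _ _ _); apply/seteqP; split => -[x v] /=.
  move=> Ax; split.
    have := Ax (@lshift 1 n 0); rewrite /cons_cV (@col_mxEu _ 1 n 1) mxE.
    by rewrite (_ : lshift n 0 = 0) ?mulr1n//; exact/val_inj.
  move=> i; have := Ax (@rshift 1 n i); rewrite /cons_cV (@col_mxEd _ 1 n 1).
  by rewrite (_ : rshift 1 i = lift 0 i)//; exact/val_inj.
move=> [A0 Av] i; case: (@split_ordP 1 n i) => k ->; rewrite /cons_cV.
  rewrite (@col_mxEu _ 1 n 1) mxE ord1 eqxx mulr1n.
  by rewrite (_ : lshift n 0 = 0)//; exact/val_inj.
rewrite (@col_mxEd _ 1 n 1) (_ : rshift 1 k = lift 0 k)//; exact/val_inj.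
Qed.

End borel.
Arguments lebesgue_cV : clear implicits.

Section circle.
Variable R : realType.

Definition cis (t : R) : R[i] := (cos (2 * pi * t) +i* sin (2 * pi * t))%C.

Lemma measurable_cis : measurable_fun setT (cis : measurableTypeR R -> R[i]).
Proof.
have mM : measurable_fun setT (fun t : R => 2 * pi * t) by exact: mulrl_measurable.
apply: measurable_complexP.
- apply: (measurableT_comp _ mM).
  by apply: continuous_measurable_fun; exact: continuous_cos.
- apply: (measurableT_comp _ mM).
  by apply: continuous_measurable_fun; exact: continuous_sin.
Qed.
HB.instance Definition _ := isMeasurableFun.Build _ _ _ _
  (cis : measurableTypeR R -> R[i]) measurable_cis.

Lemma cisD t u : cis (t + u) = cis t * cis u.
Proof. by rewrite /cis mulrDr cosD sinD; simpc; congr Complex; rewrite addrC. Qed.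

Lemma cisN t : cis (- t) = (cis t)^*%C.
Proof. by rewrite /cis mulrN cosN sinN. Qed.

Lemma cis0 : cis 0 = 1.
Proof. by rewrite /cis mulr0 cos0 sin0. Qed.

Lemma norm_cis t : `|cis t| = 1.
Proof. by rewrite /cis normc_def /= cos2Dsin2 sqrtr1. Qed.

Definition circle : set R[i] := [set z | `|z| = 1].

Definition haar_circle : probability R[i] R :=
  distribution (uniform_prob (@ltr01 R)) (cis : measurableTypeR R -> R[i]).

End circle.

Section dot.
Variables (R : realType) (n : nat).
Implicit Types (x y : 'cV[R]_n) (V : {vspace 'cV[R]_n}).

Definition dot x y : R := \sum_(i < n) x i 0 * y i 0.

Lemma dotNr x y : dot x (- y) = - dot x y.
Proof. by rewrite /dot -sumrN; apply: eq_bigr => i _; rewrite mxE mulrN. Qed.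

Definition gram V : 'M[R]_(\dim V) :=
  \matrix_(i, j) dot (vbasis V)`_i (vbasis V)`_j.

Definition lincomb V (c : 'cV[R]_(\dim V)) : 'cV[R]_n :=
  \sum_(i < \dim V) c i 0 *: (vbasis V)`_i.

Lemma measurable_lincomb V : measurable_fun setT (@lincomb V).
Proof.
apply: measurable_mxP => i j; rewrite /lincomb.
under eq_fun do rewrite summxE.
apply: measurable_sum => k.
under eq_fun do rewrite mxE.
apply: measurable_funM => //; exact: measurable_coord_mx.
Qed.
HB.instance Definition _ V :=
  isMeasurableFun.Build _ _ _ _ (@lincomb V) (@measurable_lincomb V).

Lemma measurable_coord_vbasis V i :
  measurable_fun setT (coord (vbasis V) i : 'cV[R]_n -> R).
Proof.
have -> : (coord (vbasis V) i : 'cV[R]_n -> R) =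
    fun x => \sum_(j < n) x j 0 * coord (vbasis V) i (delta_mx j 0).
  apply/funext => x; rewrite {1}(matrix_sum_delta x) linear_sum.
  by apply: eq_bigr => j _; rewrite big_ord1 linearZ.
apply: measurable_sum => j.
by apply: measurable_funM => //; exact: measurable_coord_mx.
Qed.

Definition lebesgue_span V : set 'cV[R]_n -> \bar R :=
  pushforward (lebesgue_cV R (\dim V)) (@lincomb V).

Section lebesgue_span.
Variable V : {vspace 'cV[R]_n}.

Let lebesgue_span0 : lebesgue_span V set0 = 0%E.
Proof. exact: measure0. Qed.

Let lebesgue_span_ge0 A : (0 <= lebesgue_span V A)%E.
Proof. exact: measure_ge0. Qed.

Let lebesgue_span_sigma_additive : semi_sigma_additive (lebesgue_span V).
Proof. exact: measure_semi_sigma_additive. Qed.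

HB.instance Definition _ := isMeasure.Build _ _ _ (lebesgue_span V)
  lebesgue_span0 lebesgue_span_ge0 lebesgue_span_sigma_additive.
End lebesgue_span.

Definition lebesgue_sub V : set 'cV[R]_n -> \bar R :=
  mscale (NngNum (sqrtr_ge0 (\det (gram V)))) (lebesgue_span V).

Section lebesgue_sub.
Variable V : {vspace 'cV[R]_n}.
HB.instance Definition _ := Measure.on (lebesgue_sub V).

Let coord_lincomb (c : 'cV[R]_(\dim V)) i :
  coord (vbasis V) i (lincomb c) = c i 0.
Proof. exact/coord_sum_free/basis_free/vbasisP. Qed.

Let lebesgue_sub_sigma_finite : sigma_finite setT (lebesgue_sub V).
Proof.
exists (fun k => [set x : 'cV[R]_n |
    forall i, `[- k%:R, k%:R]%classic (coord (vbasis V) i x)]).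
  apply/esym; rewrite -subTset => x _.
  pose r : R := \sum_i `|coord (vbasis V) i x|.
  exists (Num.truncn r).+1 => //= i; rewrite in_itv/= -ler_norml.
  apply: le_trans (ltW (truncnS_gt r)).
  by rewrite /r (bigD1 i)//= lerDl sumr_ge0.
move=> k; split.
  rewrite (_ : [set _ | _] = \big[setI/setT]_i
      (coord (vbasis V) i @^-1` `[- k%:R, k%:R]%classic)).
    apply: bigsetI_measurable => i _; rewrite -[X in measurable X]setTI.
    exact: measurable_coord_vbasis.
  rewrite -bigcap_seq; apply/seteqP; split => x /= Ax i; first by move=> _; exact: Ax.
  by apply: Ax; exact: mem_index_enum.
rewrite /lebesgue_sub /mscale lte_mul_pinfty//.
rewrite [ltLHS](_ : _ = lebesgue_cV R (\dim V)
    [set c | forall i, `[- k%:R, k%:R]%classic (c i 0)]).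
  rewrite (@lebesgue_cV_box _ _ (fun=> `[- k%:R, k%:R]%classic))//.
  set p := (\prod_(i < _) _)%E; suff /andP[] : (0 <= p < +oo)%E by [].
  rewrite /p; elim/big_ind : _ => [|x y /andP[x0 xoo] /andP[y0 yoo]|i _].
  - by rewrite lee01 ltry.
  - by rewrite mule_ge0//= lte_mul_pinfty// ge0_fin_numE.
  - by rewrite measure_ge0 /= lebesgue_measure_itv; case: ifP; rewrite ltry.
rewrite /lebesgue_span /pushforward; congr (lebesgue_cV _ _ _).
by apply/seteqP; split => c /= h i; have := h i; rewrite coord_lincomb.
Qed.
HB.instance Definition _ := Measure_isSigmaFinite.Build _ _ _
  (lebesgue_sub V) lebesgue_sub_sigma_finite.
End lebesgue_sub.

End dot.

Section transforms.
Variables (R : realType) (n : nat).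
Implicit Types (psi : 'cV[R]_n -> R[i]) (x xi y : 'cV[R]_n).

Definition integralC (f : 'cV[R]_n -> R[i]) : R[i] :=
  (Rintegral (lebesgue_cV R n) setT (fun y => complex.Re (f y)) +i*
   Rintegral (lebesgue_cV R n) setT (fun y => complex.Im (f y)))%C.

Definition fourier psi xi : R[i] :=
  integralC (fun x => psi x * cis (- dot xi x)).

Definition wigner psi x xi : R[i] :=
  integralC (fun y =>
    cis (- dot xi y) * psi (x + 2^-1 *: y) * (psi (x - 2^-1 *: y))^*%C).

Definition memLp (p : nat) psi :=
  measurable_fun setT psi /\
  (\int[lebesgue_cV R n]_x (normc (psi x) ^+ p)%:E < +oo)%E.

End transforms.

Notation affWH R n := (R[i] * 'cV[R]_n * 'cV[R]_n * 'M[R]_n)%type.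

Section affine_weyl_heisenberg.
Variables (R : realType) (n : nat).
Implicit Types (g : affWH R n) (G : set (affWH R n)) (h : 'M[R]_n).
Implicit Types (V : {vspace 'cV[R]_n}) (H : set 'M[R]_n).

Definition GL : set 'M[R]_n := [set h | h \in unitmx].

Definition affWH_group : set (affWH R n) :=
  [set g | circle g.1.1.1 /\ GL g.2].

Definition affWH_one : affWH R n := (1, 0, 0, 1%:M).

Definition affWH_mul g1 g2 : affWH R n :=
  let: (z1, x1, xi1, h1) := g1 in
  let: (z2, x2, xi2, h2) := g2 in
  (z1 * z2 * cis (dot xi1 (h1 *m x2)), x1 + h1 *m x2,
   xi1 + (invmx h1)^T *m xi2, h1 *m h2).

Definition affWH_inv g : affWH R n :=
  let: (z, x, xi, h) := g in
  (z^-1 * cis (dot xi x), - (invmx h *m x), - (h^T *m xi), invmx h).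

Definition affWH_subgroup G :=
  [/\ G `<=` affWH_group, G affWH_one,
      forall g1 g2, G g1 -> G g2 -> G (affWH_mul g1 g2) &
      forall g, G g -> G (affWH_inv g)].

Definition sympl_form : 'M[R]_(n + n) := block_mx 0 1%:M (- 1%:M) 0.

Definition Sp : set 'M[R]_(n + n) :=
  [set B | B^T *m sympl_form *m B = sympl_form].

Definition affWH_embed g : (R[i] * 'cV[R]_n * 'cV[R]_n) * 'M[R]_(n + n) :=
  (g.1, block_mx g.2 0 0 (invmx g.2)^T).

Definition HSp_act (a : (R[i] * 'cV[R]_n * 'cV[R]_n) * 'M[R]_(n + n))
    (y : 'cV[R]_(n + n)) : 'cV[R]_(n + n) :=
  a.2 *m y + col_mx a.1.1.2 a.1.2.

Definition tc_group V H : set (affWH R n) :=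
  [set g | [/\ circle g.1.1.1, g.1.2 \in V & H g.2]].

Definition closed_subgroup_GL H :=
  [/\ H `<=` GL, H 1%:M, forall h k, H h -> H k -> H (h *m k),
      forall h, H h -> H (invmx h) & closure H `&` GL `<=` H].

Definition translation_complete V H :=
  closed_subgroup_GL H /\ forall h v, H h -> v \in V -> h^T *m v \in V.

Definition det_on V (A : 'M[R]_n) : R :=
  \det (\matrix_(i, j < \dim V) coord (vbasis V) j (A *m (vbasis V)`_i)).

Definition left_haar H (mu : {measure set 'M[R]_n -> \bar R}) :=
  [/\ mu (~` H) = 0%E, (0 < mu H)%E,
      forall K, compact K -> K `<=` H -> (mu K < +oo)%E &
      forall h A, H h -> measurable A -> A `<=` H ->
        mu [set h *m a | a in A] = mu A].

Lemma affWH_mulV g : affWH_group g -> affWH_mul g (affWH_inv g) = affWH_one.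
Proof.
case: g => [[[z x] xi] h] [/= z1 hu]; rewrite /affWH_one.
have z0 : z != 0 by rewrite -normr_eq0 z1 oner_eq0.
rewrite mulmxN mulKVmx// dotNr mulrA mulfV// mul1r -cisD subrr cis0 subrr.
by rewrite mulmxN mulmxA -trmx_mul mulmxV// trmx1 mul1mx subrr.
Qed.

Lemma affWH_embed_Sp g : affWH_group g -> Sp (affWH_embed g).2.
Proof.
case: g => [[[z x] xi] h] [/= _ hu]; rewrite /Sp/= /sympl_form.
rewrite tr_block_mx !mulmx_block !trmx0 trmxK.
rewrite !(mulmx0, mul0mx, mulmx1, mulmxN, mulNmx, addr0, add0r).
by rewrite -trmx_mul mulVmx// trmx1.
Qed.

Lemma HSp_act_inv g x xi : affWH_group g ->
  HSp_act (affWH_embed (affWH_inv g)) (col_mx x xi) =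
  col_mx (invmx g.2 *m (x - g.1.1.2)) (g.2^T *m (xi - g.1.2)).
Proof.
case: g => [[[z p] q] h] [/= _ hu]; rewrite /HSp_act/=.
rewrite mul_block_col !mul0mx addr0 add0r invmxK add_col_mx.
by rewrite !mulmxBr.
Qed.

Lemma tc_group_subgroup V H :
  translation_complete V H -> affWH_subgroup (tc_group V H).
Proof.
move=> [[HGL H1 HM Hinv _] VH].
have stab h v : H h -> v \in V -> (invmx h)^T *m v \in V.
  by move=> Hh; apply: VH; exact: Hinv.
split.
- by move=> [[[z x] xi] h] [/= z1 _ /HGL].
- by split => /=; [exact: normr1|exact: mem0v|].
- move=> [[[z1 x1] xi1] h1] [[[z2 x2] xi2] h2] [/= c1 v1 H1'] [/= c2 v2 H2'].
  split => /=; last exact: HM.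
    by rewrite /circle/= !normrM c1 c2 norm_cis !mulr1.
  by rewrite memvD// stab.
- move=> [[[z x] xi] h] [/= c v Hh]; split => /=; last exact: Hinv.
    by rewrite /circle/= normrM normfV c norm_cis invr1 mulr1.
  by rewrite memvN VH.
Qed.

End affine_weyl_heisenberg.

Definition integral_defined d (T : measurableType d) (R : realType)
    (mu : set T -> \bar R) (D : set T) (f : T -> \bar R) :=
  (\int[mu]_(t in D) f^\+ t < +oo)%E \/ (\int[mu]_(t in D) f^\- t < +oo)%E.

(* Main.v *)
(* Substituting [(u, v) = (x + y/2, x - y/2)], which preserves Lebesgue measure,
   the integral of [W_psi(., eta)] factors as the Fourier integral of [psi] at
   [eta] times its conjugate; Fubini applies because [psi] is in [L^1].  Hence
   [W_psi(., eta)] is integrable with integral [|psi^(eta)|^2] for every [eta].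
   In the fibre over [(q, h)] the map [p |-> h^-1 (x - p)] scales Lebesgue
   measure by [1/|det h|], so the integral over the circle and [R^n] of the
   Wigner expression is [|psi^(h^T (xi - q))|^2].  What remains is Tonelli on the
   positive and negative parts, where the Haar measure of [H] is sigma-finite
   because [H] is a countable union of compact sets. *)

Require Import Defs.
From HB Require Import structures.
From mathcomp Require Import all_boot all_order all_algebra perm.
From mathcomp Require Import all_classical all_reals all_analysis.
From mathcomp Require Import measurable_realfun complex ring.

Set Implicit Arguments.
Unset Strict Implicit.
Unset Printing Implicit Defensive.

Import Order.TTheory GRing.Theory Num.Theory numFieldNormedType.Exports.
Import ComplexField.Normc.

Local Open Scope classical_set_scope.
Local Open Scope ring_scope.

(** The measure [lebesgue_cV] is built one coordinate at a time through [cons_cV], so every change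
    of variables is reduced to affine maps of the line: invertible matrices are factored into
    block-triangular ones, and the map to [(u, v)] into two translations. The pair [(q, h)] stays a
    parameter: only [p] is substituted, and the factor [det_on V h^T] passes to the other side
    unchanged. The delicate point is that the Wigner distribution is signed. Its integrals over the
    fibres converge absolutely, but this alone does not bound the positive or the negative part of
    the integral over the group, which is why that integral is treated under the assumption that it
    is defined. All measures live on ambient spaces of complex numbers, vectors and matrices, so the
    group and its factors have to be shown Borel, and integrands are extended by zero. *)

(** * Affine changes of variable on the line *)

(** Uniqueness of Lebesgue measure leaves only intervals []c, d]] to check. For [a < 0] the preimage
    is closed on the left and open on the right, whence the two cases. *)
Lemma lebesgue_measure_affine (R : realType) (a b : R) (A : set R) :
  a != 0 -> measurable A ->
  (`|a|%:E * @lebesgue_measure R ((fun x => (a * x + b)%R) @^-1` A))%E =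
  @lebesgue_measure R A.
Proof.
move=> a0 mA.
have mphi : measurable_fun setT
    ((fun x => a * x + b) : measurableTypeR R -> measurableTypeR R).
  by apply: measurable_funD => //; exact: mulrl_measurable.
pose phi : {mfun measurableTypeR R >-> measurableTypeR R} :=
  @mfun_Sub _ _ (measurableTypeR R) (measurableTypeR R) _ (mem_set mphi).
rewrite [RHS](@lebesgue_measure_unique R
  (mscale (NngNum (normr_ge0 a)) (pushforward (@lebesgue_measure R) phi)))//.
move=> _ [[c d] _ <-]; rewrite -[RHS]/(`|a|%:E * @lebesgue_measure R
  ((fun x => (a * x + b)%R) @^-1` `]c, d]%classic))%E.
rewrite lebesgue_measure_itv/= lte_fin.
have [lea|lta|a00] := ltgtP a 0; last by rewrite a00 eqxx in a0.
  rewrite (_ : _ @^-1` _ = `[(d - b) / a, (c - b) / a[%classic).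
    rewrite lebesgue_measure_itv/= lte_fin ltr_ndivrMr// divfK// ltrD2r.
    case: ifPn => _; last by rewrite mule0.
    by rewrite -!EFinB -EFinM; congr EFin; rewrite ltr0_norm//; field.
  apply/seteqP; split => x /=; rewrite !in_itv/= => /andP[h1 h2];
    apply/andP; split.
  - by rewrite ler_ndivrMr// mulrC lerBrDr.
  - by rewrite ltr_ndivlMr// mulrC ltrBlDr.
  - by move: h2; rewrite ltr_ndivlMr// ltrBlDr mulrC.
  - by move: h1; rewrite ler_ndivrMr// lerBrDr mulrC.
rewrite (_ : _ @^-1` _ = `](c - b) / a, (d - b) / a]%classic).
  rewrite lebesgue_measure_itv/= lte_fin ltr_pdivrMr// divfK// ltrD2r.
  case: ifPn => _; last by rewrite mule0.
  by rewrite -!EFinB -EFinM; congr EFin; rewrite gtr0_norm//; field.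
apply/seteqP; split => x /=; rewrite !in_itv/= => /andP[h1 h2];
  apply/andP; split.
- by rewrite ltr_pdivrMr// mulrC ltrBlDr.
- by rewrite ler_pdivlMr// mulrC lerBrDr.
- by move: h1; rewrite ltr_pdivrMr// ltrBlDr mulrC.
- by move: h2; rewrite ler_pdivlMr// lerBrDr mulrC.
Qed.

Lemma ge0_integral_affine (R : realType) (a b : R)
    (f : measurableTypeR R -> \bar R) :
  a != 0 -> measurable_fun setT f -> (forall x, (0 <= f x)%E) ->
  (`|a|%:E * \int[@lebesgue_measure R]_x f (a * x + b)%R =
   \int[@lebesgue_measure R]_x f x)%E.
Proof.
move=> a0 mf f0.
have mphi : measurable_fun setT
    ((fun x => a * x + b) : measurableTypeR R -> measurableTypeR R).
  by apply: measurable_funD => //; exact: mulrl_measurable.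
pose phi : {mfun measurableTypeR R >-> measurableTypeR R} :=
  @mfun_Sub _ _ (measurableTypeR R) (measurableTypeR R) _ (mem_set mphi).
have [nu nuE] : exists nu : {measure set (measurableTypeR R) -> \bar R},
    nu = pushforward (@lebesgue_measure R) phi :> (set _ -> \bar R).
  by exists (measure_function_pushforward__canonical__measure_function_Measure
    (@lebesgue_measure R) mphi).
transitivity (\int[mscale (NngNum (normr_ge0 a)) nu]_x f x)%E.
  rewrite ge0_integral_mscale// nuE (ge0_integral_pushforward mphi)//.
by apply: eq_measure_integral => A mA _; rewrite -[LHS]/(_ * nu A)%E nuE; exact: lebesgue_measure_affine.
Qed.

(** * Integration over column vectors by splitting off the first coordinate *)

Lemma ge0_integral_cons (R : realType) (n : nat) (f : 'cV[R]_n.+1 -> \bar R) :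
  measurable_fun setT f -> (forall x, (0 <= f x)%E) ->
  (\int[lebesgue_cV R n.+1]_x f x =
   \int[@lebesgue_measure R]_x \int[lebesgue_cV R n]_v f (cons_cV (x, v)))%E.
Proof.
move=> mf f0.
transitivity (\int[pushforward (@lebesgue_measure R \x lebesgue_cV R n)
  (@cons_cV R n)]_x f x)%E; first by [].
rewrite (ge0_integral_pushforward (@measurable_cons_cV R n))// preimage_setT.
rewrite fubini_tonelli1//; last by move=> z; exact: f0.
exact: (measurableT_comp mf (@measurable_cons_cV R n)).
Qed.

(** This order of integration serves maps that move the first coordinate by an amount depending on
    the others, as upper block-triangular matrices do. *)
Lemma ge0_integral_cons_swap (R : realType) (n : nat) (f : 'cV[R]_n.+1 -> \bar R) :
  measurable_fun setT f -> (forall x, (0 <= f x)%E) ->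
  (\int[lebesgue_cV R n.+1]_x f x =
   \int[lebesgue_cV R n]_v \int[@lebesgue_measure R]_x f (cons_cV (x, v)))%E.
Proof.
move=> mf f0.
transitivity (\int[pushforward (@lebesgue_measure R \x lebesgue_cV R n)
  (@cons_cV R n)]_x f x)%E; first by [].
rewrite (ge0_integral_pushforward (@measurable_cons_cV R n))// preimage_setT.
rewrite fubini_tonelli2//; last by move=> z; exact: f0.
exact: (measurableT_comp mf (@measurable_cons_cV R n)).
Qed.

(** * Measurability of matrix operations *)

Lemma measurable_mulmx (R : realType) d (T : measurableType d) (m n p : nat)
    (f : T -> 'M[R]_(m, n)) (g : T -> 'M[R]_(n, p)) :
  measurable_fun setT f -> measurable_fun setT g ->
  measurable_fun setT (fun t => f t *m g t).
Proof.
move=> mf mg; apply: measurable_mxP => i j; under eq_fun do rewrite mxE.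
apply: measurable_sum => k; apply: measurable_funM.
  exact: measurableT_comp (measurable_coord_mx i k) mf.
exact: measurableT_comp (measurable_coord_mx k j) mg.
Qed.

Lemma measurable_mulmxl (R : realType) (m n p : nat) (A : 'M[R]_(m, n)) :
  measurable_fun setT (fun B : 'M[R]_(n, p) => A *m B).
Proof. by apply: measurable_mulmx. Qed.

Lemma measurable_addmx (R : realType) d (T : measurableType d) (m n : nat)
    (f g : T -> 'M[R]_(m, n)) :
  measurable_fun setT f -> measurable_fun setT g ->
  measurable_fun setT (fun t => f t + g t).
Proof.
move=> mf mg; apply: measurable_mxP => i j; under eq_fun do rewrite mxE.
apply: measurable_funD.
  exact: measurableT_comp (measurable_coord_mx i j) mf.
exact: measurableT_comp (measurable_coord_mx i j) mg.
Qed.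

Lemma measurable_scalemx (R : realType) d (T : measurableType d) (m n : nat)
    (k : T -> measurableTypeR R) (f : T -> 'M[R]_(m, n)) :
  measurable_fun setT k -> measurable_fun setT f ->
  measurable_fun setT (fun t => (k t : R) *: f t).
Proof.
move=> mk mf; apply: measurable_mxP => i j; under eq_fun do rewrite mxE.
apply: measurable_funM => //.
exact: measurableT_comp (measurable_coord_mx i j) mf.
Qed.

Lemma measurable_oppmx (R : realType) d (T : measurableType d) (m n : nat)
    (f : T -> 'M[R]_(m, n)) :
  measurable_fun setT f -> measurable_fun setT (fun t => - f t).
Proof.
move=> mf; under eq_fun do rewrite -scaleN1r.
by apply: measurable_scalemx.
Qed.

Lemma measurable_trmx (R : realType) d (T : measurableType d) (m n : nat)
    (f : T -> 'M[R]_(m, n)) :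
  measurable_fun setT f -> measurable_fun setT (fun t => (f t)^T).
Proof.
move=> mf; apply: measurable_mxP => i j; under eq_fun do rewrite mxE.
exact: measurableT_comp (measurable_coord_mx j i) mf.
Qed.

(** * Translation invariance *)

Lemma cons_cVD (R : realType) (n : nat) (x y : R) (v w : 'cV[R]_n) :
  cons_cV (x, v) + cons_cV (y, w) = cons_cV (x + y, v + w).
Proof. by rewrite /cons_cV/= (@add_col_mx _ 1 n 1) -raddfD. Qed.

Lemma cV_eq_cons (R : realType) (n : nat) (b : 'cV[R]_(1 + n)) :
  b = cons_cV (b 0 0, dsubmx b).
Proof.
rewrite /cons_cV/= -{1}(vsubmxK b) [usubmx b]mx11_scalar mxE.
by rewrite (_ : lshift n 0 = 0)//; exact/val_inj.
Qed.

(** Induction on the dimension: the inner integral absorbs the tail of [b], the outer one its head,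
    as an affine map of slope 1. *)
Lemma ge0_integral_cV_shift (R : realType) (n : nat) (b : 'cV[R]_n)
    (f : 'cV[R]_n -> \bar R) :
  measurable_fun setT f -> (forall x, (0 <= f x)%E) ->
  (\int[lebesgue_cV R n]_x f (x + b)%R = \int[lebesgue_cV R n]_x f x)%E.
Proof.
elim: n b f => [|n IHn] b f mf f0.
  by apply: eq_integral => x _; rewrite (flatmx0 b) addr0.
have mfb : measurable_fun setT (fun x : 'cV[R]_n.+1 => f (x + b)).
  by apply: measurableT_comp => //; exact: measurable_addmx.
rewrite (cV_eq_cons b).
move: (b 0 0) (dsubmx _) => {mfb}c w.
have mfb : measurable_fun setT (fun x : 'cV[R]_n.+1 => f (x + cons_cV (c, w))).
  by apply: measurableT_comp => //; exact: measurable_addmx.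
rewrite !ge0_integral_cons//.
under eq_integral => x _.
  under eq_integral do rewrite cons_cVD.
  rewrite (IHn _ (fun v => f (cons_cV (x + c, v))))//; last first.
    apply: measurableT_comp => //.
    apply: (measurableT_comp (@measurable_cons_cV R n)).
    exact: pair1_measurable.
  over.
pose F (x : measurableTypeR R) := (\int[lebesgue_cV R n]_v f (cons_cV (x, v)))%E.
have mF : measurable_fun setT F.
  apply: (measurable_fun_fubini_tonelli_F (f \o @cons_cV R n)) => //=.
  exact: (measurableT_comp mf (@measurable_cons_cV R n)).
have F0 x : (0 <= F x)%E by exact: integral_ge0.
transitivity (\int[@lebesgue_measure R]_x F (x + c)%R)%E; first by [].
have := ge0_integral_affine c (oner_neq0 R) mF F0.
rewrite normr1 mul1e; under eq_integral do rewrite mul1r.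
exact.
Qed.

(** * Linear changes of variable *)

Lemma det_cons_ublock (R : comNzRingType) (n : nat) (a : R) (b : 'rV[R]_n)
    (D : 'M[R]_n) :
  \det (block_mx a%:M b 0 D : 'M[R]_(1 + n)) = a * \det D.
Proof. by rewrite det_ublock det_scalar1. Qed.

Lemma mul_ublock_cons (R : realType) (n : nat) (a : R) (b : 'rV[R]_n)
    (D : 'M[R]_n) (x : R) (v : 'cV[R]_n) :
  (block_mx a%:M b 0 D : 'M[R]_(1 + n)) *m cons_cV (x, v) =
  cons_cV (a * x + (b *m v) 0 0, D *m v).
Proof.
rewrite /cons_cV/= (@mul_block_col _ 1 n 1 n 1) mul0mx add0r.
by rewrite raddfD/= scalar_mxM -mx11_scalar.
Qed.

Lemma mul_lblock_cons (R : realType) (n : nat) (c : 'cV[R]_n)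
    (x : R) (v : 'cV[R]_n) :
  (block_mx 1%:M 0 c 1%:M : 'M[R]_(1 + n)) *m cons_cV (x, v) =
  cons_cV (x, v + x *: c).
Proof.
rewrite /cons_cV/= (@mul_block_col _ 1 n 1 n 1) !mul1mx mul0mx addr0.
by rewrite mul_mx_scalar addrC.
Qed.

Lemma ulsubmx00 (R : realType) (n : nat) (A : 'M[R]_(1 + n)) :
  A 0 0 = ulsubmx A 0 0.
Proof. by rewrite !mxE; congr (A _ _); exact/val_inj. Qed.

(** Stated for functions rather than sets, so that it can be applied to an inner integral; with the
    determinant on the left it is visibly multiplicative in [A]. *)
Definition scales_lebesgue (R : realType) (n : nat) (A : 'M[R]_n) : Prop :=
  forall f : 'cV[R]_n -> \bar R,
  measurable_fun setT f -> (forall x, (0 <= f x)%E) ->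
  (`|\det A|%:E * \int[lebesgue_cV R n]_x f (A *m x)%R =
   \int[lebesgue_cV R n]_x f x)%E.

Lemma scales_lebesgueM (R : realType) (n : nat) (A B : 'M[R]_n) :
  scales_lebesgue A -> scales_lebesgue B -> scales_lebesgue (A *m B).
Proof.
move=> hA hB f mf f0; rewrite -(hA f)// -(hB (fun x => f (A *m x)))//.
  rewrite muleA -EFinM -normrM det_mulmx.
  by under eq_integral do rewrite -mulmxA.
exact: (measurableT_comp mf (measurable_mulmxl _)).
Qed.

(** For a fixed tail [v] the first coordinate undergoes the affine map of slope [a] and offset
    [b *m v]; what is left is the action of [D] on the tail. *)
Lemma scales_lebesgue_ublock (R : realType) (n : nat) (a : R) (b : 'rV[R]_n)
    (D : 'M[R]_n) :
  a != 0 -> scales_lebesgue D ->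
  scales_lebesgue (block_mx a%:M b 0 D : 'M[R]_(1 + n)).
Proof.
move=> a0 hD f mf f0; rewrite det_cons_ublock normrM mulrC EFinM -muleA.
have mfc : measurable_fun setT (f \o @cons_cV R n).
  exact: (measurableT_comp mf (@measurable_cons_cV R n)).
have mG : measurable_fun setT
    (fun v => \int[@lebesgue_measure R]_x f (cons_cV (x, v)))%E.
  exact: (measurable_fun_fubini_tonelli_G _ mfc (fun z => f0 (cons_cV z))).
rewrite !ge0_integral_cons_swap//; last first.
  exact: (measurableT_comp mf (measurable_mulmxl _)).
rewrite -[RHS]hD//; last by move=> v; exact: integral_ge0.
congr (_ * _)%E; rewrite -ge0_integralZl//; last 2 first.
- apply: (measurable_fun_fubini_tonelli_G
    (fun p => f ((block_mx a%:M b 0 D : 'M[R]_(1 + n)) *m cons_cV p))) => //.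
  apply: measurableT_comp => //.
  by apply: measurable_mulmx => //; exact: measurable_cons_cV.
- by move=> v _; exact: integral_ge0.
apply: eq_integral => v _; under eq_integral do rewrite mul_ublock_cons.
apply: (ge0_integral_affine _ (f := fun x => f (cons_cV (x, D *m v)))) => //.
exact: (measurableT_comp mfc (pair2_measurable _)).
Qed.

(** For a fixed head [x] the tail is merely translated by [x *: c]. *)
Lemma scales_lebesgue_lblock (R : realType) (n : nat) (c : 'cV[R]_n) :
  scales_lebesgue (block_mx 1%:M 0 c 1%:M : 'M[R]_(1 + n)).
Proof.
move=> f mf f0; rewrite det_lblock !det1 mul1r normr1 mul1e.
have mfc : measurable_fun setT (f \o @cons_cV R n).
  exact: (measurableT_comp mf (@measurable_cons_cV R n)).
rewrite !ge0_integral_cons//; last first.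
  exact: (measurableT_comp mf (measurable_mulmxl _)).
apply: eq_integral => x _; under eq_integral do rewrite mul_lblock_cons.
apply: (@ge0_integral_cV_shift R n (x *: c) (fun v => f (cons_cV (x, v)))) => //.
exact: (measurableT_comp mfc (pair1_measurable _)).
Qed.

Lemma scales_lebesgue1 (R : realType) (n : nat) : scales_lebesgue (1%:M : 'M[R]_n).
Proof.
move=> f mf f0; rewrite det1 normr1 mul1e.
by apply: eq_integral => x _; rewrite mul1mx.
Qed.

(* Induction on the dimension by Schur complement; the upper shear [E] makes the
   pivot nonzero. *)
Lemma scales_lebesgue_unitmx (R : realType) (n : nat) (A : 'M[R]_n) :
  A \in unitmx -> scales_lebesgue A.
Proof.
elim: n A => [|n IHn] A.
  by move=> _; rewrite (_ : A = 1%:M) ?[LHS]flatmx0 ?[RHS]flatmx0//;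
    exact: scales_lebesgue1.
have pivot (B : 'M[R]_(1 + n)) : B \in unitmx -> B 0 0 != 0 -> scales_lebesgue B.
  move=> uB; set a := B 0 0 => a0.
  have Ba : ulsubmx B = a%:M.
    by rewrite [LHS]mx11_scalar -ulsubmx00.
  pose D := drsubmx B - a^-1 *: (dlsubmx B *m ursubmx B).
  have BE : B = block_mx 1%:M 0 (a^-1 *: dlsubmx B) 1%:M *m
      block_mx a%:M (ursubmx B) 0 D.
    rewrite mulmx_block !mul1mx !mul0mx !addr0.
    rewrite -{1}(submxK B) Ba; congr block_mx.
      by rewrite mul_mx_scalar scalerA mulfV// scale1r.
    by rewrite /D -scalemxAl addrC subrK.
  have uD : D \in unitmx.
    move: uB; rewrite !unitmxE {1}BE det_mulmx det_lblock !det1 mul1r mul1r.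
    by rewrite det_cons_ublock unitrM => /andP[].
  rewrite BE; apply: scales_lebesgueM; first exact: scales_lebesgue_lblock.
  by apply: scales_lebesgue_ublock => //; exact: IHn.
move=> uA; have [A00|] := eqVneq ((A : 'M[R]_(1 + n)) 0 0) 0; last exact: pivot.
(* If the entries below a zero pivot vanished too, [A] would be block-triangular with determinant
   0. *)
have [i Ai0] : exists i, dlsubmx (A : 'M[R]_(1 + n)) i 0 != 0.
  apply: contrapT => /forallNP dl0.
  have : \det (A : 'M[R]_(1 + n)) = 0.
    rewrite -(submxK (A : 'M[R]_(1 + n))) (_ : dlsubmx _ = 0).
      by rewrite det_ublock [ulsubmx _]mx11_scalar det_scalar1 -ulsubmx00 A00 mul0r.
    apply/matrixP => i j; rewrite ord1 [RHS]mxE; apply/eqP.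
    by have /negP := dl0 i; rewrite negbK.
  by move: uA; rewrite unitmxE => /[swap] ->; rewrite unitr0.
(* [E s] adds [s] times row [i] of the lower block to the first row, so the pivot of [E 1 *m A] is
   the nonzero entry just found; [E (-1)] undoes this. *)
pose E (s : R) : 'M[R]_(1 + n) := block_mx 1%:M (s *: delta_mx 0 i) 0 1%:M.
have EK : E (-1) *m (E 1 *m A) = A.
  rewrite mulmxA /E mulmx_block !mul1mx !mul0mx !mulmx0 !mulmx1 !addr0 !add0r.
  rewrite -scalerDl subrr scale0r; transitivity (1%:M *m A); last exact: mul1mx.
  by rewrite -scalar_mx_block.
have hE s : scales_lebesgue (E s).
  by apply: scales_lebesgue_ublock; [exact: oner_neq0|exact: scales_lebesgue1].
rewrite -EK; apply: scales_lebesgueM => //; apply: pivot.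
  rewrite unitmx_mul uA andbT unitmxE /E det_cons_ublock det1 mulr1.
  exact: unitr1.
rewrite -(submxK (A : 'M[R]_(1 + n))) /E (@mulmx_block _ 1 n 1 n 1 n) !mul1mx scale1r -rowE.
rewrite ulsubmx00 block_mxKul mxE -ulsubmx00 A00 add0r.
by move: Ai0; rewrite !mxE.
Qed.

(** * Change of variables for integrable functions, and the shear *)

(** A factor [k >= 0] commutes with positive and negative parts, so the nonnegative case suffices.
    Used for the shear with [k = 1] and for the fibre map in [p]. *)
Lemma integrable_transport d1 d2 (T1 : measurableType d1)
    (T2 : measurableType d2) (R : realType)
    (mu : {measure set T1 -> \bar R}) (nu : {measure set T2 -> \bar R})
    (k : R) (phi : T1 -> T2) (f : T2 -> \bar R) :
  (0 <= k)%R -> measurable_fun setT phi ->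
  (forall g : T2 -> \bar R, measurable_fun setT g -> (forall x, (0 <= g x)%E) ->
    (k%:E * \int[mu]_x g (phi x) = \int[nu]_x g x)%E) ->
  nu.-integrable setT f ->
  mu.-integrable setT (fun x => k%:E * f (phi x))%E /\
  (\int[mu]_x (k%:E * f (phi x)) = \int[nu]_x f x)%E.
Proof.
move=> k0 mphi hphi /integrableP[mf foo].
have mg (g : T2 -> \bar R) : measurable_fun setT g ->
    measurable_fun setT (g \o phi).
  by move=> ?; exact: measurableT_comp.
have scale (g : T2 -> \bar R) : measurable_fun setT g ->
    (forall x, (0 <= g x)%E) ->
    (\int[mu]_x (k%:E * g (phi x)) = \int[nu]_x g x)%E.
  by move=> mg' g0; rewrite ge0_integralZl ?hphi//; exact: mg.
split.
  apply/integrableP; split; first by apply: measurable_funeM; exact: mg.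
  under eq_integral do rewrite abseM abse_EFin ger0_norm//.
  rewrite (scale (abse \o f)) => [//||x]; last exact: abse_ge0.
  exact: measurableT_comp.
rewrite integralE [RHS]integralE; congr (_ - _)%E.
  rewrite -[RHS]scale => [||x]; [|exact: measurable_funepos|exact: funepos_ge0].
  by apply: eq_integral => x _; rewrite (ge0_funeposM (f \o phi) k0) funepos_comp.
rewrite -[RHS]scale => [||x]; [|exact: measurable_funeneg|exact: funeneg_ge0].
by apply: eq_integral => x _; rewrite (ge0_funenegM (f \o phi) k0) funeneg_comp.
Qed.

Lemma ge0_integral_affine_cV (R : realType) (n : nat) (A : 'M[R]_n)
    (b : 'cV[R]_n) (f : 'cV[R]_n -> \bar R) :
  A \in unitmx -> measurable_fun setT f -> (forall x, (0 <= f x)%E) ->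
  (`|\det A|%:E * \int[lebesgue_cV R n]_x f (A *m x + b)%R =
   \int[lebesgue_cV R n]_x f x)%E.
Proof.
move=> uA mf f0; rewrite -[RHS](ge0_integral_cV_shift b)//.
apply: (@scales_lebesgue_unitmx _ _ _ uA (fun x => f (x + b))) => //.
by apply: measurableT_comp => //; exact: measurable_addmx.
Qed.

Definition shear (R : realType) (n : nat) (p : 'cV[R]_n * 'cV[R]_n) :
    'cV[R]_n * 'cV[R]_n :=
  (p.1 + 2^-1 *: p.2, p.1 - 2^-1 *: p.2).

Lemma measurable_shear (R : realType) (n : nat) :
  measurable_fun setT (@shear R n).
Proof.
have mh : measurable_fun setT (fun p : 'cV[R]_n * 'cV[R]_n => 2^-1 *: p.2).
  by apply: measurable_scalemx.
apply: measurable_fun_pair; apply: measurable_addmx => //.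
exact: measurable_oppmx.
Qed.

(** Two translations, each with the other variable fixed: replacing [x] by [x + y/2] turns the
    integrand into [f (x + y, x)], and replacing [y] by [y - x] then gives [f (y, x)]. *)
Lemma ge0_integral_shear (R : realType) (n : nat)
    (f : 'cV[R]_n * 'cV[R]_n -> \bar R) :
  measurable_fun setT f -> (forall x, (0 <= f x)%E) ->
  (\int[lebesgue_cV R n \x lebesgue_cV R n]_p f (shear p) =
   \int[lebesgue_cV R n \x lebesgue_cV R n]_p f p)%E.
Proof.
move=> mf f0.
pose g (p : 'cV[R]_n * 'cV[R]_n) := f (p.1 + p.2, p.1).
have mg : measurable_fun setT g.
  apply: (measurableT_comp mf); apply: measurable_fun_pair => //.
  exact: measurable_addmx.
rewrite (fubini_tonelli2 (f \o @shear R n)); first last.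
- by move=> p; exact: f0.
- exact: measurableT_comp mf (@measurable_shear R n).
transitivity (\int[lebesgue_cV R n]_y \int[lebesgue_cV R n]_x g (x, y))%E.
  apply: eq_integral => y _.
  rewrite -(ge0_integral_cV_shift (- (2^-1 *: y)) (f := fun x => g (x, y))).
  - apply: eq_integral => x _; rewrite /g/= /shear/=; congr (f (_, _)).
    rewrite -addrA; congr (_ + _).
    by rewrite -[X in _ = _ + X]scale1r -scaleNr -scalerDl; congr (_ *: _); field.
  - exact: (measurableT_comp mg (pair2_measurable _)).
  - by move=> x; exact: f0.
rewrite -(fubini_tonelli g mg (fun _ => f0 _)) (fubini_tonelli2 f)//.
apply: eq_integral => x _; rewrite /fubini_F /g/= /fubini_G.
rewrite -(ge0_integral_cV_shift x (f := fun y => f (y, x)))//.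
  by apply: eq_integral => y _; rewrite addrC.
exact: (measurableT_comp mf (pair2_measurable _)).
Qed.

(** * Measurability of complex-valued functions *)

Lemma continuous_Re (R : realType) :
  continuous (@complex.Re R : R[i] -> R).
Proof.
move=> z W /nbhs_ballP[e /= e0 eW]; apply/nbhs_ballP.
exists (e%:C)%C => /=; first by rewrite ltcR.
move=> w; rewrite /ball/= => zw; apply: eW; rewrite /ball/= -ltcR.
by rewrite (le_lt_trans _ zw)// -raddfB; exact: normc_ge_Re.
Qed.

Lemma measurable_Re (R : realType) :
  measurable_fun setT (@complex.Re R : R[i] -> measurableTypeR R).
Proof.
apply: (measurability _ (RGenOpens.measurableE R)) => _ [_ [a [b ->] <-]].
rewrite setTI; apply: sub_sigma_algebra.
by apply: open_comp; [move=> A _; exact: continuous_Re|exact: interval_open].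
Qed.

Lemma measurable_mulcl (R : realType) (c : R[i]) :
  measurable_fun setT (fun z : R[i] => c * z).
Proof.
apply: (@measurability _ _ _ _ _ _ (@open R[i])) => // _ [U oU <-].
rewrite setTI; apply: sub_sigma_algebra; apply: open_comp => // z _.
exact: mulrl_continuous.
Qed.

(** The imaginary part of [z] is the real part of [- i z]. *)
Lemma measurable_Im (R : realType) :
  measurable_fun setT (@complex.Im R : R[i] -> measurableTypeR R).
Proof.
rewrite (_ : @complex.Im R = @complex.Re R \o (fun z => - 'i%C * z)).
  exact: measurableT_comp (@measurable_Re R) (@measurable_mulcl R _).
by apply/funext => -[a b]; rewrite /= ; simpc.
Qed.

Lemma measurable_ReP d (T : measurableType d) (R : realType) (f : T -> R[i]) :
  measurable_fun setT f -> measurable_fun setT (fun t => complex.Re (f t)).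
Proof. exact: measurableT_comp (@measurable_Re R). Qed.

Lemma measurable_ImP d (T : measurableType d) (R : realType) (f : T -> R[i]) :
  measurable_fun setT f -> measurable_fun setT (fun t => complex.Im (f t)).
Proof. exact: measurableT_comp (@measurable_Im R). Qed.

Lemma measurable_mulc d (T : measurableType d) (R : realType) (f g : T -> R[i]) :
  measurable_fun setT f -> measurable_fun setT g ->
  measurable_fun setT (fun t => f t * g t).
Proof.
move=> mf mg.
have [rf If rg Ig] : [/\ measurable_fun setT (fun t => complex.Re (f t)),
  measurable_fun setT (fun t => complex.Im (f t)),
  measurable_fun setT (fun t => complex.Re (g t)) &
  measurable_fun setT (fun t => complex.Im (g t))].
  by split; [exact: measurable_ReP|exact: measurable_ImP|
             exact: measurable_ReP|exact: measurable_ImP].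
apply: measurable_complexP.
  rewrite (_ : (fun _ => _) = (fun t => complex.Re (f t) * complex.Re (g t) -
    complex.Im (f t) * complex.Im (g t))).
    by apply: measurable_funB; exact: measurable_funM.
  by apply/funext => t; case: (f t) (g t) => [a b] [c e].
rewrite (_ : (fun _ => _) = (fun t => complex.Re (f t) * complex.Im (g t) +
  complex.Im (f t) * complex.Re (g t))).
  by apply: measurable_funD; exact: measurable_funM.
by apply/funext => t; case: (f t) (g t) => [a b] [c e].
Qed.

Lemma measurable_conjc d (T : measurableType d) (R : realType) (f : T -> R[i]) :
  measurable_fun setT f -> measurable_fun setT (fun t => (f t)^*%C).
Proof.
move=> mf; apply: measurable_complexP.
  rewrite (_ : (fun _ => _) = (fun t => complex.Re (f t))).
    exact: measurable_ReP.
  by apply/funext => t; case: (f t).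
rewrite (_ : (fun _ => _) = (fun t => - complex.Im (f t))).
  by apply: measurable_funN; exact: measurable_ImP.
by apply/funext => t; case: (f t).
Qed.

Lemma measurable_normc (R : realType) :
  measurable_fun setT (@normc R : R[i] -> R).
Proof.
rewrite (_ : @normc R = fun z : R[i] =>
    (complex.Re z ^+ 2 + complex.Im z ^+ 2) `^ 2^-1).
  apply: (measurableT_comp (measurable_powR _)).
  apply: measurable_funD; apply: measurable_funX.
    exact: measurable_Re.
  exact: measurable_Im.
by apply/funext => -[a b] /=; rewrite powR12_sqrt// addr_ge0// sqr_ge0.
Qed.

Lemma measurable_dot d (T : measurableType d) (R : realType) (n : nat)
    (f g : T -> 'cV[R]_n) :
  measurable_fun setT f -> measurable_fun setT g ->
  measurable_fun setT (fun t => dot (f t) (g t)).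
Proof.
move=> mf mg; apply: measurable_sum => i; apply: measurable_funM.
  exact: measurableT_comp (measurable_coord_mx i 0) mf.
exact: measurableT_comp (measurable_coord_mx i 0) mg.
Qed.

Lemma measurable_cisT d (T : measurableType d) (R : realType) (f : T -> R) :
  measurable_fun setT f -> measurable_fun setT (fun t => cis (f t)).
Proof. exact: measurableT_comp (@measurable_cis R). Qed.

Lemma normc_cis (R : realType) (t : R) : normc (cis t) = 1.
Proof. by rewrite /cis /= cos2Dsin2 sqrtr1. Qed.

Lemma dotBr (R : realType) (n : nat) (x y z : 'cV[R]_n) :
  dot x (y - z) = dot x y - dot x z.
Proof.
by rewrite /dot -sumrB; apply: eq_bigr => i _; rewrite !mxE mulrBr.
Qed.

(** * The marginal of the Wigner distribution *)

(** Serves twice: for two copies of the modulated [psi], and for the indicator of the circle against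
    a function of [p]. *)
Lemma integral_tensor d1 d2 (T1 : measurableType d1) (T2 : measurableType d2)
    (R : realType) (mu : {sigma_finite_measure set T1 -> \bar R})
    (nu : {sigma_finite_measure set T2 -> \bar R}) (f : T1 -> R) (g : T2 -> R) :
  mu.-integrable setT (EFin \o f) -> nu.-integrable setT (EFin \o g) ->
  (mu \x nu)%E.-integrable setT (fun p => (f p.1 * g p.2)%:E) /\
  (\int[mu \x nu]_p (f p.1 * g p.2)%:E =
   (Rintegral mu setT f * Rintegral nu setT g)%:E)%E.
Proof.
move=> intf intg.
have mf : measurable_fun setT f by exact/measurable_EFinP/(measurable_int mu).
have mg : measurable_fun setT g by exact/measurable_EFinP/(measurable_int nu).
have mfg : measurable_fun setT (fun p : T1 * T2 => (f p.1 * g p.2)%:E).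
  apply/measurable_EFinP; apply: measurable_funM.
    exact: measurableT_comp mf measurable_fst.
  exact: measurableT_comp mg measurable_snd.
have intfg : (mu \x nu)%E.-integrable setT (fun p => (f p.1 * g p.2)%:E).
  apply/(integrable12ltyP mu nu mfg).
  have fo := integrable_abse intf; have go := integrable_abse intg.
  have gfin := integrable_fin_num measurableT go.
  have g0 : (0 <= \int[nu]_y `|(EFin \o g) y|)%E by exact: integral_ge0.
  pose C := fine (\int[nu]_y `|(EFin \o g) y|)%E.
  have E x : (\int[nu]_y `|(f (x, y).1 * g (x, y).2)%:E| =
      C%:E * `|(EFin \o f) x|)%E.
    under eq_integral do rewrite /= normrM EFinM.
    rewrite ge0_integralZl//; last by do 2 apply: measurableT_comp => //.
    by rewrite muleC /C fineK.
  under eq_integral do rewrite E.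
  rewrite ge0_integralZl//; last 2 first.
  - by do 2 apply: measurableT_comp => //.
  - by rewrite lee_fin fine_ge0.
  rewrite lte_mul_pinfty// ?lee_fin ?fine_ge0//.
  by rewrite -ge0_fin_numE ?integral_ge0//; exact: integrable_fin_num.
have E x : (\int[nu]_y (f x * g y)%:E = (Rintegral nu setT g)%:E * (f x)%:E)%E.
  under eq_integral do rewrite EFinM.
  by rewrite (integralZl _ intg)// fineK ?(integrable_fin_num measurableT intg)// muleC.
split => //; rewrite -(integral12_prod_meas1 intfg)/=.
under eq_integral do rewrite /fubini_F/= E.
rewrite (integralZl _ intf)// muleC.
by rewrite EFinM [in RHS]fineK ?(integrable_fin_num measurableT intf).
Qed.

Definition modulate (R : realType) (n : nat) (psi : 'cV[R]_n -> R[i])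
    (eta u : 'cV[R]_n) : R[i] := psi u * cis (- dot eta u).

Lemma Re_mul_conjc (R : realType) (z w : R[i]) :
  complex.Re (z * w^*%C) =
  complex.Re z * complex.Re w + complex.Im z * complex.Im w.
Proof. by case: z w => [a b] [c e] /=; rewrite mulrN opprK. Qed.

Lemma conjcM (R : realType) (z w : R[i]) : (z * w)^*%C = z^*%C * w^*%C.
Proof.
case: z w => [a b] [c e]; apply/eqP; rewrite eq_complex /=.
by rewrite mulrN mulNr opprK opprD mulrN mulNr !eqxx.
Qed.

(** Since [y = u - v], the character of [y] splits into one of [u] and the conjugate of one of [v];
    each is absorbed by one copy of [psi], which becomes a Fourier integrand. *)
Lemma wigner_integrandE (R : realType) (n : nat) (psi : 'cV[R]_n -> R[i])
    (x eta y : 'cV[R]_n) :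
  cis (- dot eta y) * psi (x + 2^-1 *: y) * (psi (x - 2^-1 *: y))^*%C =
  modulate psi eta (shear (x, y)).1 * (modulate psi eta (shear (x, y)).2)^*%C.
Proof.
rewrite /shear/= /modulate; set u := x + _; set v := x - _.
have -> : y = u - v.
  rewrite /u /v opprD opprK addrACA subrr add0r -[RHS]scalerDl -[LHS]scale1r.
  by congr (_ *: _); field.
rewrite dotBr opprB addrC cisD.
rewrite conjcM -cisN opprK; set p := cis _; set q := cis _; ring.
Qed.

Lemma integrable_modulate (R : realType) (n : nat) (psi : 'cV[R]_n -> R[i])
    (eta : 'cV[R]_n) :
  memLp 1 psi ->
  (lebesgue_cV R n).-integrable setT
    (EFin \o (fun u => complex.Re (modulate psi eta u))) /\
  (lebesgue_cV R n).-integrable setT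
    (EFin \o (fun u => complex.Im (modulate psi eta u))).
Proof.
move=> [mpsi psi1].
have mmod : measurable_fun setT (modulate psi eta).
  apply: measurable_mulc => //; apply: measurable_cisT.
  by apply: measurable_funN; exact: measurable_dot.
have intpsi : (lebesgue_cV R n).-integrable setT (EFin \o (@normc R \o psi)).
  apply/integrableP; split.
    apply/measurable_EFinP.
    exact: measurableT_comp (@measurable_normc R) mpsi.
  apply: le_lt_trans psi1; rewrite le_eqVlt; apply/orP; left; apply/eqP.
  apply: eq_integral => x _ /=; rewrite ger0_norm//.
  by case: (psi x) => a b; exact: sqrtr_ge0.
have normE u : normc (modulate psi eta u) = normc (psi u).
  by rewrite normcM normc_cis mulr1.
split; apply: le_integrable intpsi => //.
- by apply/measurable_EFinP; exact: measurable_ReP.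
- move=> u _; rewrite /= lee_fin -normE.
  case: (modulate psi eta u) => a b /=; rewrite [leRHS]ger0_norm ?sqrtr_ge0//.
  by rewrite -sqrtr_sqr ler_wsqrtr// lerDl sqr_ge0.
- by apply/measurable_EFinP; exact: measurable_ImP.
- move=> u _; rewrite /= lee_fin -normE.
  case: (modulate psi eta u) => a b /=; rewrite [leRHS]ger0_norm ?sqrtr_ge0//.
  by rewrite -sqrtr_sqr ler_wsqrtr// lerDr sqr_ge0.
Qed.

Lemma wigner_marginal (R : realType) (n : nat) (psi : 'cV[R]_n -> R[i])
    (eta : 'cV[R]_n) :
  memLp 1 psi ->
  (lebesgue_cV R n).-integrable setT
    (fun x => (complex.Re (wigner psi x eta))%:E) /\
  (\int[lebesgue_cV R n]_x (complex.Re (wigner psi x eta))%:E =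
   (normc (fourier psi eta) ^+ 2)%:E)%E.
Proof.
move=> /(integrable_modulate eta)[intRe intIm].
set M := modulate psi eta in intRe intIm.
have [intRR RR] := integral_tensor intRe intRe.
have [intII II] := integral_tensor intIm intIm.
(* The real part of [M u] times the conjugate of [M v]. It is a sum of two tensors, whose integrals
   are the squares of the real and imaginary parts of the Fourier transform. *)
pose g (p : 'cV[R]_n * 'cV[R]_n) := ((complex.Re (M p.1) * complex.Re (M p.2))%:E +
  (complex.Im (M p.1) * complex.Im (M p.2))%:E)%E.
have intg : (lebesgue_cV R n \x lebesgue_cV R n)%E.-integrable setT g.
  exact: integrableD.
have intgE : (\int[lebesgue_cV R n \x lebesgue_cV R n]_p g p =
    (normc (fourier psi eta) ^+ 2)%:E)%E.
  rewrite integralD// RR II -EFinD; congr EFin.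
  by rewrite sqr_sqrtr ?addr_ge0 ?sqr_ge0// !expr2.
have [intgs intgsE] := integrable_transport ler01 (@measurable_shear R n)
  (fun f mf f0 => etrans (mul1e _) (ge0_integral_shear mf f0)) intg.
pose k p := (1%:E * g (shear p))%E.
(* Holds for every [x], because [wigner] itself is defined through [fine]. Where the section is not
   integrable the value is the default 0; Fubini confines this to a null set, discarded at the
   end. *)
have WE x : (complex.Re (wigner psi x eta))%:E =
    (fine (fubini_F (lebesgue_cV R n) k x))%:E.
  rewrite /wigner/=; congr (fine _)%:E; apply: eq_integral => y _.
  by rewrite /k mul1e wigner_integrandE Re_mul_conjc EFinD.
have mF : measurable_fun setT (fubini_F (lebesgue_cV R n) k).
  exact: measurable_fubini_F intgs.
have mW : measurable_fun setT (fun x => (complex.Re (wigner psi x eta))%:E).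
  under eq_fun do rewrite WE.
  apply/measurable_EFinP; exact: measurableT_comp mF.
split.
  apply: le_integrable (integrable_fubini_F intgs) => // x _.
  by rewrite WE; case: fubini_F => [r| |] //=; rewrite normr0 leey.
rewrite -intgE -intgsE -(integral12_prod_meas1 intgs).
apply: ae_eq_integral => //; apply: filterS (ae_integrable1 intgs) => x intx _.
by apply: (etrans (WE x)); rewrite fineK//; exact: (integrable_fin_num measurableT intx).
Qed.

(** * Closed subgroups of [GL] and their Haar measures *)

Lemma closed_measurable_mx (R : realType) (m n : nat) (A : set 'M[R]_(m, n)) :
  closed A -> measurable A.
Proof.
move=> cA; rewrite -[A]setCK; apply: measurableC.
by apply: sub_sigma_algebra; exact: closed_openC.
Qed.

Lemma compact_mx_box (R : realType) (m n : nat) (M : R) :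
  compact [set A : 'M[R]_(m, n) | forall i j, `|A i j| <= M].
Proof.
have cvec : continuous (@vec_mx R m n).
  move=> v W /nbhs_ballP[e /= e0 eW]; apply/nbhs_ballP; exists e => // w [_ vw].
  by apply: eW; split => // i j; rewrite !mxE; exact: vw.
rewrite (_ : mkset _ = vec_mx @`
    [set v : 'rV[R]_(m * n) | forall i, `[- M, M]%classic (v ord0 i)]).
  apply: continuous_compact; first exact: continuous_subspaceT.
  apply: (@rV_compact _ _ (fun=> `[- M, M]%classic)) => _.
  exact: segment_compact.
apply/seteqP; split => [A AM|_ [v vM <-] i j] /=.
  exists (mxvec A); last exact: mxvecK.
  by case/mxvec_indexP => i j /=; rewrite mxvecE in_itv/= -ler_norml.
by rewrite mxE ler_norml; have := vM (mxvec_index i j); rewrite /= in_itv.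
Qed.

Lemma continuous_det (R : realType) (n : nat) :
  continuous (fun A : 'M[R]_n => \det A).
Proof.
move=> A.
apply: (@cvg_big R _ _ _ _ (@add_continuous R) _ (nbhs A) _
  (fun (s : 'S_n) (B : 'M[R]_n) => (-1) ^+ s * \prod_i B i (s i))) => s _.
apply: (@cvgM _ _ (nbhs A) _ (fun=> (-1) ^+ s)
  (fun B : 'M[R]_n => \prod_i B i (s i))); first exact: cvg_cst.
apply: (@cvg_big R _ _ _ _ (@mul_continuous R) _ (nbhs A) _
  (fun i (B : 'M[R]_n) => B i (s i))) => i _.
exact: coord_continuous.
Qed.

Lemma measurable_det (R : realType) (n : nat) :
  measurable_fun setT (fun A : 'M[R]_n => \det A).
Proof.
apply: measurable_sum => s; apply: measurable_funM => //.
by apply: measurable_prod => i _; exact: measurable_coord_mx.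
Qed.

Lemma measurable_GL (R : realType) (n : nat) : measurable (@GL R n).
Proof.
rewrite (_ : @GL R n = (fun A => \det A) @^-1` [set~ 0]).
  rewrite -[X in measurable X]setTI; apply: measurable_det => //.
  exact: measurableC.
apply/seteqP; split => A; rewrite /GL/= unitmxE unitfE; first by move/eqP.
by move=> /eqP.
Qed.

(** Closedness is relative to [GL], so [H] may fail to be closed among all matrices; this form shows
    that it is still Borel. *)
Lemma closed_subgroup_GLE (R : realType) (n : nat) (H : set 'M[R]_n) :
  closed_subgroup_GL H -> H = closure H `&` @GL R n.
Proof.
move=> [HGL _ _ _ clH]; apply/seteqP; split => // h Hh.
by split; [exact: subset_closure|exact: HGL].
Qed.

Lemma closed_subgroup_GL_measurable (R : realType) (n : nat) (H : set 'M[R]_n) :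
  closed_subgroup_GL H -> measurable H.
Proof.
move=> /closed_subgroup_GLE ->; apply: measurableI; last exact: measurable_GL.
by apply: closed_measurable_mx; exact: closed_closure.
Qed.

(* [H] is the increasing union of its compact parts where the entries and the
   inverse of the determinant are bounded. *)
Lemma left_haar_sigma_finite (R : realType) (n : nat) (H : set 'M[R]_n)
    (mu : {measure set 'M[R]_n -> \bar R}) :
  closed_subgroup_GL H -> left_haar H mu -> sigma_finite setT mu.
Proof.
move=> clH [muNH _ mucpt _].
(* The closure of [H] may contain singular matrices. The lower bound on the determinant is a closed
   condition that excludes them, which makes [K k] compact and keeps it inside [H]. *)
pose K k : set 'M[R]_n := [set h : 'M[R]_n | forall i j, `|h i j| <= k.+1%:R] `&`
  (closure H `&` [set h : 'M[R]_n | k.+1%:R^-1 <= `|\det h|]).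
have KH k : K k `<=` H.
  move=> h [_ [clh dh]]; rewrite (closed_subgroup_GLE clH); split => //.
  rewrite /GL/= unitmxE unitfE -normr_gt0; apply: lt_le_trans dh.
  by rewrite invr_gt0.
have cK k : closed (closure H `&` [set h : 'M[R]_n | k.+1%:R^-1 <= `|\det h|]).
  apply: closedI; first exact: closed_closure.
  apply: (@preimage_closed _ _ (fun h : 'M[R]_n => `|\det h|) [set x | k.+1%:R^-1 <= x]).
    move=> h _; apply: (@continuous_comp _ _ _ (fun A : 'M[R]_n => \det A)).
      exact: continuous_det.
    exact: norm_continuous.
  exact: closed_ge.
have kK k : compact (K k).
  by apply: compact_closedI => //; exact: compact_mx_box.
have mH := closed_subgroup_GL_measurable clH.
(* Index 0 is spent on the complement of [H], a null set, since the cover must exhaust all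
   matrices. *)
exists (fun k => if k is k'.+1 then K k' else ~` H); last first.
  move=> [|k]; first by split; [exact: measurableC|rewrite [ltLHS]muNH ltry].
  split; last exact: mucpt.
  apply: closed_measurable_mx; apply: compact_closed => //.
apply/esym; rewrite -subTset => h _.
have [Hh|nHh] := pselect (H h); last by exists 0%N.
have : 0 < `|\det h|.
  by case: clH => /(_ _ Hh); rewrite /GL/= unitmxE unitfE normr_gt0.
(* One number dominating both the inverse determinant and every entry of [h]. *)
move=> d0; pose M := `|\det h|^-1 + \sum_i \sum_j `|h i j|.
have M0 : 0 <= \sum_i \sum_j `|h i j|.
  by apply: sumr_ge0 => i _; apply: sumr_ge0.
have MN : M <= (Num.truncn M).+1%:R by rewrite ltW// truncnS_gt.
exists (Num.truncn M).+1 => //=; split.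
  move=> i j; apply: le_trans MN; rewrite /M (bigD1 i)//= (bigD1 j)//=.
  rewrite -[leLHS]add0r lerD ?invr_ge0// -addrA lerDl addr_ge0 ?sumr_ge0//.
  by move=> k _; exact: sumr_ge0.
split; first exact: subset_closure.
rewrite /= -[leRHS]invrK lef_pV2 ?posrE ?invr_gt0//.
by apply: le_trans MN; rewrite lerDl.
Qed.

(** * Measurability of the circle, the Wigner distribution, inverses and [V] *)

Lemma circleE (R : realType) : @circle R = @normc R @^-1` [set 1].
Proof.
apply/seteqP; split => -[a b]; rewrite /circle/= normc_def/=; first by case.
by move=> ->.
Qed.

Lemma measurable_circle (R : realType) : measurable (@circle R).
Proof.
rewrite circleE -[X in measurable X]setTI.
by apply: measurable_normc => //; exact: measurable_set1.
Qed.

Lemma haar_circle_circle (R : realType) : haar_circle R (@circle R) = 1%E.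
Proof.
rewrite /haar_circle/= /distribution /pushforward.
rewrite (_ : _ @^-1` _ = setT); first exact: probability_setT.
by apply/seteqP; split => // t _; exact: norm_cis.
Qed.

(** The integral is by definition the difference of the integrals of the two parts, each measurable
    in [x] by Tonelli, so a signed integrand is allowed. *)
Lemma measurable_integral_snd d1 d2 (T1 : measurableType d1)
    (T2 : measurableType d2) (R : realType)
    (mu : {sigma_finite_measure set T2 -> \bar R}) (f : T1 * T2 -> \bar R) :
  measurable_fun setT f ->
  measurable_fun setT (fun x => \int[mu]_y f (x, y))%E.
Proof.
move=> mf; under eq_fun do rewrite integralE.
apply: emeasurable_funB.
  apply: eq_measurable_fun (measurable_fun_fubini_tonelli_F (m2 := mu) _
    (measurable_funepos mf) (funepos_ge0 f)) => x _.
  by apply: eq_integral => y _; rewrite !funeposE.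
apply: eq_measurable_fun (measurable_fun_fubini_tonelli_F (m2 := mu) _
  (measurable_funeneg mf) (funeneg_ge0 f)) => x _.
by apply: eq_integral => y _; rewrite !funenegE.
Qed.

Lemma measurable_wigner (R : realType) (n : nat) (psi : 'cV[R]_n -> R[i]) :
  measurable_fun setT psi ->
  measurable_fun setT
    (fun p : 'cV[R]_n * 'cV[R]_n => complex.Re (wigner psi p.1 p.2)).
Proof.
move=> mpsi; pose k (p : ('cV[R]_n * 'cV[R]_n) * 'cV[R]_n) : R[i] :=
  cis (- dot p.1.2 p.2) * psi (p.1.1 + 2^-1 *: p.2) *
  (psi (p.1.1 - 2^-1 *: p.2))^*%C.
rewrite (_ : (fun _ => _) = fine \o
    (fun p => \int[lebesgue_cV R n]_y (complex.Re (k (p, y)))%:E)%E)//.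
apply: measurableT_comp => //.
apply: (@measurable_integral_snd _ _ _ _ _ _ (fun p => (complex.Re (k p))%:E)).
apply/measurable_EFinP; apply: measurable_ReP.
have m2 : measurable_fun setT
    (fun p : ('cV[R]_n * 'cV[R]_n) * 'cV[R]_n => 2^-1 *: p.2).
  by apply: measurable_scalemx.
have m11 : measurable_fun setT
    (fun p : ('cV[R]_n * 'cV[R]_n) * 'cV[R]_n => p.1.1).
  exact: measurableT_comp measurable_fst measurable_fst.
have m12 : measurable_fun setT
    (fun p : ('cV[R]_n * 'cV[R]_n) * 'cV[R]_n => p.1.2).
  exact: measurableT_comp measurable_snd measurable_fst.
apply: measurable_mulc; first apply: measurable_mulc.
- by apply: measurable_cisT; apply: measurable_funN; exact: measurable_dot.
- by apply: measurableT_comp mpsi _; exact: measurable_addmx.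
- apply: measurable_conjc; apply: measurableT_comp mpsi _.
  by apply: measurable_addmx => //; exact: measurable_oppmx.
Qed.

(** Writes [x^-1] as [x] times a power of the nonnegative [x ^+ 2]; at 0 the factor [x] reproduces
    the default value 0. *)
Lemma measurable_invr (R : realType) :
  measurable_fun setT (GRing.inv : R -> R).
Proof.
rewrite (_ : GRing.inv = fun x : R => x * (x ^+ 2) `^ (-1)).
  apply: measurable_funM => //.
  exact: (measurableT_comp (measurable_powR _)).
apply/funext => x; rewrite powR_inv1 ?sqr_ge0//.
have [->|x0] := eqVneq x 0; first by rewrite invr0 mul0r.
by rewrite expr2 invfM mulrA mulfV// mul1r.
Qed.

Lemma measurable_adjugate (R : realType) (n : nat) :
  measurable_fun setT (fun A : 'M[R]_n => \adj A).
Proof.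
apply: measurable_mxP => i j; under eq_fun do rewrite mxE.
rewrite /cofactor; apply: measurable_funM => //.
apply: (measurableT_comp (@measurable_det R n.-1)).
apply: measurable_mxP => k l; under eq_fun do rewrite !mxE.
exact: measurable_coord_mx.
Qed.

Lemma measurable_det_on (R : realType) (n : nat) (V : {vspace 'cV[R]_n}) :
  measurable_fun setT (det_on V).
Proof.
apply: (measurableT_comp (@measurable_det R (\dim V))).
apply: measurable_mxP => i j; under eq_fun do rewrite mxE.
apply: (measurableT_comp (@measurable_coord_vbasis R n V j)).
exact: measurable_mulmx.
Qed.

Lemma measurable_vspace (R : realType) (n : nat) (V : {vspace 'cV[R]_n}) :
  measurable [set q | q \in V].
Proof.
(* The coordinates are linear functionals on the whole space, so the residue [r] is measurable
   everywhere; it vanishes exactly on [V]. *)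
pose r (q : 'cV[R]_n) : 'cV[R]_n :=
  q - \sum_(i < \dim V) coord (vbasis V) i q *: (vbasis V)`_i.
have mr i : measurable_fun setT (fun q => r q i 0).
  rewrite /r; under eq_fun do rewrite !mxE summxE.
  apply: measurable_funB; first exact: measurable_coord_mx.
  apply: measurable_sum => j; under eq_fun do rewrite mxE.
  by apply: measurable_funM => //; exact: measurable_coord_vbasis.
rewrite (_ : mkset _ =
    r @^-1` [set x : 'cV[R]_n | forall i, [set (0 : R)]%classic (x i 0)]).
  rewrite -[X in measurable X]setTI; apply: measurable_mxP => //.
    by move=> i j; rewrite ord1.
  by apply: (@measurable_box R n (fun=> [set 0])) => i; exact: measurable_set1.
apply/seteqP; split => q /=.
  by move=> qV i; rewrite /r -coord_vbasis// subrr mxE.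
move=> r0; have /eqP : r q = 0.
  by apply/matrixP => i j; rewrite ord1 r0 mxE.
rewrite subr_eq0 => /eqP ->; apply: memv_suml => i _; apply: memvZ.
by apply: vbasis_mem; apply: mem_nth; rewrite size_tuple.
Qed.

(** * Tonelli for triple products of sigma-finite measures *)

(** An alias carrying the proof of sigma-finiteness, so that the structure can be attached to a
    measure given abstractly, such as a Haar measure. *)
Definition sigma_finite_pack d (T : measurableType d) (R : realType)
  (mu : {measure set T -> \bar R}) of sigma_finite setT mu :
  set T -> \bar R := mu.
HB.instance Definition _ d (T : measurableType d) (R : realType)
    (mu : {measure set T -> \bar R}) (sf : sigma_finite setT mu) :=
  Measure.copy (sigma_finite_pack sf) mu.
HB.instance Definition _ d (T : measurableType d) (R : realType)
    (mu : {measure set T -> \bar R}) (sf : sigma_finite setT mu) :=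
  Measure_isSigmaFinite.Build _ _ _ (sigma_finite_pack sf) sf.

Lemma sigma_finite_measureP d (T : measurableType d) (R : realType)
    (mu : {measure set T -> \bar R}) :
  sigma_finite setT mu ->
  exists nu : {sigma_finite_measure set T -> \bar R},
    nu = mu :> (set T -> \bar R).
Proof. by move=> sf; exists (sigma_finite_pack sf). Qed.

(* The canonical sigma-finite structure on [m1 \x m2] is not found by inference:
   the key is taken by the instance for subprobabilities. *)
Lemma product_sigma_finite_measure d1 d2 (T1 : measurableType d1)
    (T2 : measurableType d2) (R : realType)
    (m1 : {sigma_finite_measure set T1 -> \bar R})
    (m2 : {sigma_finite_measure set T2 -> \bar R}) :
  exists nu : {sigma_finite_measure set (T1 * T2)%type -> \bar R},
    nu = (m1 \x m2)%E :> (set (T1 * T2)%type -> \bar R).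
Proof.
apply: sigma_finite_measureP.
have /sigma_finiteP[F [TF ndF Foo]] := sigma_finiteT m1.
have /sigma_finiteP[G [TG ndG Goo]] := sigma_finiteT m2.
exists (fun k => F k `*` G k).
  rewrite -setXTT TF TG predeqE => -[x y]; split.
    move=> [/= [k _ Fkx] [l _ Gly]]; exists (maxn k l) => //; split.
    - by move: x Fkx; exact/subsetPset/ndF/leq_maxl.
    - by move: y Gly; exact/subsetPset/ndG/leq_maxr.
  by move=> [k _ []/= ? ?]; split; exists k.
move=> k; have [? ?] := Foo k; have [? ?] := Goo k.
split; first exact: measurableX.
by rewrite [ltLHS]product_measure1E// lte_mul_pinfty// ge0_fin_numE.
Qed.

(** The product associates to the left, yet the first variable is integrated out alone: both sides
    are compared through iterated integrals, and the reassociated [g] supplies measurability. *)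
Lemma ge0_integral_prod3 d1 d2 d3 (T1 : measurableType d1)
    (T2 : measurableType d2) (T3 : measurableType d3) (R : realType)
    (m1 : {sigma_finite_measure set T1 -> \bar R})
    (m2 : {sigma_finite_measure set T2 -> \bar R})
    (m3 : {sigma_finite_measure set T3 -> \bar R})
    (f : T1 * T2 * T3 -> \bar R) :
  measurable_fun setT f -> (forall x, (0 <= f x)%E) ->
  measurable_fun setT (fun p : T2 * T3 => \int[m1]_x f (x, p.1, p.2))%E /\
  (\int[m1 \x m2 \x m3]_p f p =
   \int[m2 \x m3]_p \int[m1]_x f (x, p.1, p.2))%E.
Proof.
move=> mf f0.
pose g (p : T1 * (T2 * T3)) := f (p.1, p.2.1, p.2.2).
have mg : measurable_fun setT g.
  apply: (measurableT_comp mf); apply: measurable_fun_pair.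
    apply: measurable_fun_pair => //.
    exact: measurableT_comp measurable_fst measurable_snd.
  exact: measurableT_comp measurable_snd measurable_snd.
have mG : measurable_fun setT (fun p : T2 * T3 => \int[m1]_x f (x, p.1, p.2))%E.
  exact: (measurable_fun_fubini_tonelli_G g mg (fun _ => f0 _)).
split => //; pose G (p : T2 * T3) : \bar R := (\int[m1]_x f (x, p.1, p.2))%E.
have G0 p : (0 <= G p)%E by exact: integral_ge0.
transitivity (\int[m3]_h \int[m1 \x m2]_p f (p, h))%E.
  have [m12 m12E] := product_sigma_finite_measure m1 m2.
  by rewrite -m12E; exact: (fubini_tonelli2 f mf f0).
transitivity (\int[m3]_h \int[m2]_q G (q, h))%E; last first.
  exact/esym/(fubini_tonelli2 G mG G0).
apply: eq_integral => h _.
have mfh : measurable_fun setT (fun p => f (p, h)).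
  exact: (measurableT_comp mf (pair2_measurable h)).
exact: (fubini_tonelli2 _ mfh (fun p => f0 (p, h))).
Qed.

(* Tonelli applied to the positive and negative parts: nonnegativity of the
   inner integrals makes the negative part finite as soon as either one is. *)
Lemma integral_prod3_defined d1 d2 d3 (T1 : measurableType d1)
    (T2 : measurableType d2) (T3 : measurableType d3) (R : realType)
    (m1 : {sigma_finite_measure set T1 -> \bar R})
    (m2 : {sigma_finite_measure set T2 -> \bar R})
    (m3 : {sigma_finite_measure set T3 -> \bar R})
    (f : T1 * T2 * T3 -> \bar R) (v : T2 * T3 -> \bar R) :
  measurable_fun setT f ->
  (forall p, m1.-integrable setT (fun x => f (x, p.1, p.2))) ->
  (forall p, (\int[m1]_x f (x, p.1, p.2) = v p)%E) ->
  (forall p, (0 <= v p)%E) ->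
  integral_defined (m1 \x m2 \x m3)%E setT f ->
  (\int[m1 \x m2 \x m3]_p f p = \int[m2 \x m3]_p v p)%E.
Proof.
move=> mf intf fv v0.
have [mA AE] := ge0_integral_prod3 m1 m2 m3 (measurable_funepos mf)
  (funepos_ge0 f).
have [mB BE] := ge0_integral_prod3 m1 m2 m3 (measurable_funeneg mf)
  (funeneg_ge0 f).
rewrite /integral_defined [X in X -> _]/= AE BE [in X in _ -> X]integralE AE BE.
set A := (fun p : T2 * T3 => \int[m1]_x f^\+ _)%E in mA *.
set B := (fun p : T2 * T3 => \int[m1]_x f^\- _)%E in mB *.
have A0 p : (0 <= A p)%E by apply: integral_ge0 => x _; exact: funepos_ge0.
have B0 p : (0 <= B p)%E by apply: integral_ge0 => x _; exact: funeneg_ge0.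
have Ap p : A p = (\int[m1]_x (fun x => f (x, p.1, p.2))^\+ x)%E.
  by apply: eq_integral => x _; rewrite !funeposE.
have Bp p : B p = (\int[m1]_x (fun x => f (x, p.1, p.2))^\- x)%E.
  by apply: eq_integral => x _; rewrite !funenegE.
have Bfin p : B p \is a fin_num.
  rewrite Bp; exact: (integrable_neg_fin_num measurableT (intf p)).
have vE p : v p = (A p - B p)%E by rewrite -fv integralE Ap Bp.
have mv : measurable_fun setT v.
  by rewrite (_ : v = A \- B)%E; [exact: emeasurable_funB|exact/funext].
(* As [B] is finite pointwise, [v = A - B] becomes [A = v + B], an identity of nonnegative functions
   that integrates without any finiteness. *)
have AB : (\int[m2 \x m3]_p A p =
    \int[m2 \x m3]_p v p + \int[m2 \x m3]_p B p)%E.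
  rewrite -ge0_integralD//; apply: eq_integral => p _.
  by rewrite vE subeK.
move=> h; have Boo : (\int[m2 \x m3]_p B p < +oo)%E.
  case: h => //; apply: le_lt_trans; rewrite AB leeDr//.
  exact: integral_ge0.
by rewrite AB addeK// ge0_fin_numE// integral_ge0.
Qed.

(** * Fibres over [(q, h)] *)

(** The integrand does not depend on [z] and the circle has mass 1: extended by zero, it is the
    tensor of an indicator with [F]. *)
Lemma integral_haar_circle_prod (R : realType) (n : nat) (F : 'cV[R]_n -> R) :
  (lebesgue_cV R n).-integrable setT (EFin \o F) ->
  (haar_circle R \x lebesgue_cV R n)%E.-integrable (@circle R `*` setT)
    (fun zp => (F zp.2)%:E) /\
  (\int[haar_circle R \x lebesgue_cV R n]_(zp in @circle R `*` setT)
     (F zp.2)%:E = \int[lebesgue_cV R n]_p (F p)%:E)%E.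
Proof.
move=> intF.
have mC := @measurable_circle R.
have int1 : (haar_circle R).-integrable setT (EFin \o (\1_(@circle R) : R[i] -> R)).
  exact: integrable_indic mC.
have [intT TE] := integral_tensor int1 intF.
have restrictE : (fun zp : R[i] * 'cV[R]_n => (F zp.2)%:E) \_ (@circle R `*` setT) =
    (fun zp => (\1_(@circle R) zp.1 * F zp.2)%:E).
  apply/funext => -[z p]; rewrite patchE indicE/= in_setX in_setT andbT/=.
  by case: (z \in _); rewrite /= ?mul1r ?mul0r.
split.
  apply/integrable_mkcond; first exact: measurableX.
  by rewrite restrictE.
rewrite integral_mkcond restrictE TE EFinM.
rewrite [X in (X * _)%E](_ : _ = 1%E) ?mul1e; last first.
  by rewrite /Rintegral integral_indic// setIT [X in fine X]haar_circle_circle.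
by rewrite fineK//; exact: (integrable_fin_num measurableT intF).
Qed.

Lemma wigner_fiber (R : realType) (n : nat) (psi : 'cV[R]_n -> R[i])
    (x eta : 'cV[R]_n) (h : 'M[R]_n) :
  memLp 1 psi -> h \in unitmx ->
  (lebesgue_cV R n).-integrable setT (EFin \o (fun p =>
    complex.Re (wigner psi (invmx h *m (x - p)) eta) / `|\det h|)) /\
  (\int[lebesgue_cV R n]_p
     (complex.Re (wigner psi (invmx h *m (x - p)) eta) / `|\det h|)%:E =
   (normc (fourier psi eta) ^+ 2)%:E)%E.
Proof.
move=> psi1 uh; have [intW WE] := wigner_marginal eta psi1.
(* The linear part of [p |-> h^-1 (x - p)] is [- invmx h], so the weight [1/|det h|] is exactly its
   Jacobian. *)
have dA : `|\det (- invmx h)| = `|\det h|^-1.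
  by rewrite -scaleN1r detZ normrM normrX normrN1 expr1n mul1r det_inv normfV.
have uA : - invmx h \in unitmx.
  by rewrite unitmxE unitfE -normr_gt0 dA invr_gt0 normr_gt0 -unitfE -unitmxE.
pose phi p : 'cV[R]_n := - invmx h *m p + invmx h *m x.
have mphi : measurable_fun setT phi.
  by apply: measurable_addmx => //; exact: measurable_mulmxl.
have [intT TE] := integrable_transport (normr_ge0 _) mphi
  (fun f mf f0 => ge0_integral_affine_cV (invmx h *m x) uA mf f0) intW.
have phiE p : (`|\det (- invmx h)|%:E *
    (complex.Re (wigner psi (phi p) eta))%:E)%E =
    (complex.Re (wigner psi (invmx h *m (x - p)) eta) / `|\det h|)%:E.
  by rewrite dA -EFinM mulrC /phi mulmxBr mulNmx addrC.
split; first by apply: eq_integrable intT => // p _; exact: phiE.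
by rewrite -WE -TE; apply: eq_integral => p _; rewrite -phiE.
Qed.

(** * Measurability of the group and of the integrand on it *)

Lemma invmx_adjugate (R : realType) (n : nat) (h : 'M[R]_n) :
  h \in unitmx -> invmx h = (\det h)^-1 *: \adj h.
Proof. by rewrite /invmx => ->. Qed.

Lemma measurable_tc_group (R : realType) (n : nat) (V : {vspace 'cV[R]_n})
    (H : set 'M[R]_n) :
  closed_subgroup_GL H -> measurable (tc_group V H).
Proof.
move=> clH; rewrite (_ : tc_group V H =
    ((@circle R `*` setT) `*` [set q | q \in V]) `*` H).
  apply: measurableX; last exact: closed_subgroup_GL_measurable.
  apply: measurableX; last exact: measurable_vspace.
  by apply: measurableX => //; exact: measurable_circle.
apply/seteqP; split => -[[[z p] q] h] /=; first by case.
by case=> [[[? ?] ?] ?].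
Qed.

(** The inverse is replaced by Cramer's formula, which is measurable on all matrices and agrees with
    [invmx] on [GL]. *)
Lemma measurable_tc_integrand (R : realType) (n : nat) (V : {vspace 'cV[R]_n})
    (psi : 'cV[R]_n -> R[i]) (x xi : 'cV[R]_n) :
  measurable_fun setT psi ->
  measurable_fun setT (fun g : R[i] * 'cV[R]_n * 'cV[R]_n * 'M[R]_n =>
    (complex.Re (wigner psi (((\det g.2)^-1 *: \adj g.2) *m (x - g.1.1.2))
      (g.2^T *m (xi - g.1.2))) * (`|det_on V g.2^T| / `|\det g.2|))%:E).
Proof.
move=> mpsi; pose T := (R[i] * 'cV[R]_n * 'cV[R]_n * 'M[R]_n)%type.
have m2 : measurable_fun setT (fun g : T => g.2) by exact: measurable_snd.
have m12 : measurable_fun setT (fun g : T => g.1.2).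
  exact: measurableT_comp measurable_snd measurable_fst.
have m112 : measurable_fun setT (fun g : T => g.1.1.2).
  exact: measurableT_comp measurable_snd
    (measurableT_comp measurable_fst measurable_fst).
have md : measurable_fun setT (fun g : T => \det g.2).
  exact: measurableT_comp (@measurable_det R n) m2.
have mt : measurable_fun setT (fun g : T => g.2^T) by exact: measurable_trmx.
have mx : measurable_fun setT (fun g : T => x - g.1.1.2).
  by apply: measurable_addmx => //; exact: measurable_oppmx.
have mxi : measurable_fun setT (fun g : T => xi - g.1.2).
  by apply: measurable_addmx => //; exact: measurable_oppmx.
have mdV : measurable_fun setT (fun g : T => (\det g.2)^-1).
  exact: measurableT_comp (@measurable_invr R) md.
have mi : measurable_fun setT
    (fun g : T => ((\det g.2)^-1 *: \adj g.2) *m (x - g.1.1.2)).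
  apply: measurable_mulmx mx; apply: measurable_scalemx mdV _.
  exact: measurableT_comp (@measurable_adjugate R n) m2.
have mh : measurable_fun setT (fun g : T => g.2^T *m (xi - g.1.2)).
  exact: measurable_mulmx mt mxi.
apply/measurable_EFinP; apply: measurable_funM.
  exact: (measurableT_comp (measurable_wigner mpsi) (measurable_fun_pair mi mh)).
apply: measurable_funM.
  exact: measurableT_comp (@normr_measurable R setT)
    (measurableT_comp (@measurable_det_on R n V) mt).
apply: (measurableT_comp (@measurable_invr R)).
exact: measurableT_comp (@normr_measurable R setT) md.
Qed.

(** * Equality of the two admissibility expressions *)

Unset Implicit Arguments.

(** [W] takes a real part because the Wigner distribution is real: reflecting [y] conjugates its
    integrand. The iterated form is always meaningful, by absolute convergence on the fibres; the
    form over the group is asserted when one of the two parts of [w] has finite integral. *)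
Theorem proposition5p4 (R : realType) (n : nat)
    (V : {vspace 'cV[R]_n}) (H : set 'M[R]_n)
    (muH : {measure set 'M[R]_n -> \bar R})
    (psi : 'cV[R]_n -> R[i]) :
  translation_complete V H ->
  connected (tc_group V H) ->
  left_haar H muH ->
  memLp 1 psi ->
  memLp 2 psi ->
  forall x : 'cV[R]_n, {ae lebesgue_cV R n, forall xi : 'cV[R]_n,
    let W (g : affWH R n) : R :=
      let y := HSp_act (affWH_embed (affWH_inv g)) (col_mx x xi) in
      complex.Re (wigner psi (usubmx y) (dsubmx y)) in
    let wavelet_side : \bar R :=
      (\int[lebesgue_sub V \x muH]_(qh in [set q | q \in V] `*` H)
        (normc (fourier psi (qh.2^T *m (xi - qh.1))) ^+ 2 *
         `|det_on V qh.2^T|)%:E)%E in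
    [/\ forall q h, q \in V -> H h ->
          (haar_circle R \x lebesgue_cV R n)%E.-integrable
            (@circle R `*` setT)
            (fun zp => (W (zp.1, zp.2, q, h) / `|\det h|)%:E),
        (\int[lebesgue_sub V \x muH]_(qh in [set q | q \in V] `*` H)
          (`|det_on V qh.2^T|%:E *
           \int[haar_circle R \x lebesgue_cV R n]_(zp in @circle R `*` setT)
             (W (zp.1, zp.2, qh.1, qh.2) / `|\det qh.2|)%:E))%E
        = wavelet_side &
        let haar_G :=
          (haar_circle R \x lebesgue_cV R n \x lebesgue_sub V \x muH)%E in
        let w (g : affWH R n) : \bar R :=
          (W g * (`|det_on V g.2^T| / `|\det g.2|))%:E in
        integral_defined haar_G (tc_group V H) w ->
        (\int[haar_G]_(g in tc_group V H) w g)%E = wavelet_side]}.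
Proof.
move=> [clH VH] _ hH psi1 _ x.
have [mu muE] := sigma_finite_measureP (left_haar_sigma_finite clH hH).
(* The marginal identity holds at every frequency, so no exceptional [xi] arises. *)
apply: aeW => xi; rewrite -muE.
pose W (g : affWH R n) : R :=
  let y := HSp_act (affWH_embed (affWH_inv g)) (col_mx x xi) in
  complex.Re (wigner psi (usubmx y) (dsubmx y)).
have HGL : H `<=` @GL R n by case: clH.
have mH := closed_subgroup_GL_measurable clH.
have mV := measurable_vspace V.
have mC := @measurable_circle R.
have WE z p q h : circle z -> GL h -> W (z, p, q, h) =
    complex.Re (wigner psi (invmx h *m (x - p)) (h^T *m (xi - q))).
  move=> cz uh.
  by rewrite /W (@HSp_act_inv R n (z, p, q, h))// col_mxKu col_mxKd.
pose E (qh : 'cV[R]_n * 'M[R]_n) : R :=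
  normc (fourier psi (qh.2^T *m (xi - qh.1))) ^+ 2.
pose I q h (zp : R[i] * 'cV[R]_n) : \bar R :=
  (W (zp.1, zp.2, q, h) / `|\det h|)%:E.
have inner q h : GL h ->
    (haar_circle R \x lebesgue_cV R n)%E.-integrable (@circle R `*` setT) (I q h) /\
    (\int[haar_circle R \x lebesgue_cV R n]_(zp in @circle R `*` setT) I q h zp =
      (E (q, h))%:E)%E.
  move=> uh; have [intW intWE] := wigner_fiber x (h^T *m (xi - q)) psi1 uh.
  have [intI IE] := integral_haar_circle_prod intW.
  have IW zp : zp \in @circle R `*` setT ->
      (complex.Re (wigner psi (invmx h *m (x - zp.2)) (h^T *m (xi - q))) /
       `|\det h|)%:E = I q h zp.
    by move=> /set_mem[cz _]; rewrite /I WE.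
  split; first by apply: eq_integrable intI => //; exact: measurableX.
  by rewrite -intWE -IE; apply: eq_integral => zp /IW.
split.
- by move=> q h _ /HGL uh; have [intI _] := inner q h uh; exact: intI.
- apply: eq_integral => -[q h] /set_mem[/= qV /HGL uh].
  have [_ IE] := inner q h uh.
  transitivity (`|det_on V h^T|%:E * (E (q, h))%:E)%E.
    by congr (_ * _)%E; exact: IE.
  by rewrite -EFinM mulrC.
pose haar_G := (haar_circle R \x lebesgue_cV R n \x lebesgue_sub V \x mu)%E.
pose w (g : affWH R n) : \bar R :=
  (W g * (`|det_on V g.2^T| / `|\det g.2|))%:E.
pose D := tc_group V H.
have mD : measurable D by exact: measurable_tc_group.
(* The action is written out and the inverse replaced by Cramer's formula; agreement with [w] on [D]
   is all that the restricted integral sees. *)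
pose f (g : R[i] * 'cV[R]_n * 'cV[R]_n * 'M[R]_n) : \bar R :=
  (complex.Re (wigner psi (((\det g.2)^-1 *: \adj g.2) *m (x - g.1.1.2))
     (g.2^T *m (xi - g.1.2))) * (`|det_on V g.2^T| / `|\det g.2|))%:E.
have wf : w \_ D = f \_ D.
  apply/funext => -[[[z p] q] h]; rewrite !patchE; case: ifPn => // /set_mem[/= cz _ /HGL uh].
  by rewrite /w /f/= WE// invmx_adjugate.
have mf : measurable_fun setT f := measurable_tc_integrand V x xi (proj1 psi1).
have mfD : measurable_fun setT (f \_ D).
  by apply/(measurable_restrictT _ mD); exact: measurable_funTS.
pose VxH : set ('cV[R]_n * 'M[R]_n) := [set q | q \in V] `*` H.
pose e (qh : 'cV[R]_n * 'M[R]_n) : \bar R := (E qh * `|det_on V qh.2^T|)%:E.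
(* Domains are traded for extension by zero, so that Tonelli applies on full spaces; off [VxH] both
   sides vanish. *)
have fiber q h :
    (haar_circle R \x lebesgue_cV R n)%E.-integrable setT
      (fun zp => (f \_ D) (zp, q, h)) /\
    (\int[haar_circle R \x lebesgue_cV R n]_zp (f \_ D) (zp, q, h) =
      (e \_ VxH) (q, h))%E.
  have [[qV Hh]|nqh] := pselect (VxH (q, h)).
    have [intI IE] := inner q h (HGL _ Hh).
    pose J zp := (`|det_on V h^T|%:E * I q h zp)%E.
    have fJ : (fun zp => (f \_ D) (zp, q, h)) = J \_ (@circle R `*` setT).
      apply/funext => -[z p]; rewrite -wf !patchE.
      have -> : ((z, p, q, h) \in D) = ((z, p) \in @circle R `*` setT).
        by apply/idP/idP => /set_mem[/= cz *]; apply: mem_set; split.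
      by case: ifP => // _; rewrite /w /J /I/= -EFinM mulrCA.
    have intJ : (haar_circle R \x lebesgue_cV R n)%E.-integrable
        (@circle R `*` setT) J.
      by apply: integrableZl => //; exact: measurableX.
    rewrite fJ; split.
      by apply/(integrable_mkcond _ (measurableX mC measurableT)).
    rewrite -integral_mkcond patchE mem_set// /J integralZl//.
      by rewrite IE -EFinM mulrC.
    exact: measurableX.
  have f0 : (fun zp => (f \_ D) (zp, q, h)) = cst 0%E.
    apply/funext => zp; rewrite patchE memNset// => -[_ /= qV Hh].
    exact: nqh.
  by rewrite f0 integral0 patchE memNset//; split => //; exact: integrable0.
(* The circle and the translations are merged into one sigma-finite factor, which turns the fourfold
   product into a triple one. *)
have [hl hlE] := product_sigma_finite_measure (haar_circle R) (lebesgue_cV R n).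
suff main : integral_defined haar_G D w ->
    (\int[haar_G]_(g in D) w g = \int[lebesgue_sub V \x mu]_(qh in VxH) e qh)%E.
  exact: main.
rewrite /haar_G -hlE in fiber *.
move=> wdef0; have wdef : integral_defined (hl \x lebesgue_sub V \x mu)%E setT (f \_ D).
  rewrite /integral_defined -wf funepos_restrict funeneg_restrict.
  by rewrite -!integral_mkcond.
rewrite integral_mkcond [RHS]integral_mkcond wf.
have int_f p : hl.-integrable setT (fun zp => (f \_ D) (zp, p.1, p.2)).
  by case: p => q h; have [] := fiber q h.
have fe p : (\int[hl]_zp (f \_ D) (zp, p.1, p.2) = (e \_ VxH) p)%E.
  by case: p => q h; have [_ ->] := fiber q h.
have e0 p : (0 <= (e \_ VxH) p)%E.
  by rewrite patchE; case: ifP => // _; rewrite lee_fin mulr_ge0 ?sqr_ge0.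
exact: (integral_prod3_defined mfD int_f fe e0 wdef).
Qed.
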